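(* Let $X$ be a proper metric space such that $\operatorname{trasInd} X<\infty$. Then $\operatorname{asInd} X<\infty$.
   Context: A metric space $(X,d)$ is proper if every closed ball is compact. A base point $x_0\in X$ is fixed in each (nonempty) proper metric space; $B_r(x)$ is the open ball of radius $r$ around $x$. Distances between sets are infima, with $d(\emptyset,\cdot)=\infty$. Two subsets $A_1,A_2\subset X$ are asymptotically disjoint if $\lim_{r\to\infty} d(A_1\setminus B_r(x_0),A_2\setminus B_r(x_0))=\infty$. A map $\phi:X\to[0,1]$ is slowly oscillating if for every $r>0$ and $\varepsilon>0$ there is $D>0$ such that $\operatorname{diam}\phi(B_r(x))<\varepsilon$ for all $x$ with $d(x,x_0)\ge D$. Let $C_h(X)$ be the set of all continuous slowly oscillating functions $X\to[0,1]$. The Higson compactification $cX$ is the closure of the image of $X$ under the embedding $X\to[0,1]^{C_h(X)}$, $x\mapsto(\phi(x))_{\phi\in C_h(X)}$; the Higson corona is $\nu X=cX\setminus X$. For $C\subset X$ put $C'=\operatorname{cl}_{cX}(C)\cap\nu X$. A partition between disjoint closed subsets $F_1,F_2$ of a topological space $T$ is a subset $P\subset T$ such that $T\setminus P=U_1\cup U_2$ with $U_1,U_2$ disjoint open subsets of $T$, $F_1\subset U_1$, $F_2\subset U_2$. For asymptotically disjoint $A_1,A_2\subset X$, a closed subset $C\subset X$ is an asymptotic separator for $A_1$ and $A_2$ if $C'$ is a partition between $A_1'$ and $A_2'$ in $\nu X$. The dimension $\operatorname{asInd}$ is defined for proper metric spaces inductively (closed subsets of proper metric spaces are proper metric spaces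 with the restricted metric): $\operatorname{asInd}X=-1$ iff $X$ is bounded (the empty set counts as bounded); for an integer $n\ge 0$, $\operatorname{asInd}X\le n$ if for every two asymptotically disjoint sets $A,B\subset X$ there is an asymptotic separator $C$ for $A$ and $B$ with $\operatorname{asInd}C\le n-1$. $\operatorname{asInd}X=n$ if $\operatorname{asInd}X\le n$ and not $\operatorname{asInd}X\le n-1$; $\operatorname{asInd}X=\infty$ if $\operatorname{asInd}X\le n$ holds for no $n$. The transfinite extension $\operatorname{trasInd}$ takes values in $\{-1\}\cup\{\text{ordinals}\}\cup\{\infty\}$ (with $-1$ smaller than every ordinal and $\infty$ larger than every ordinal): $\operatorname{trasInd}X=-1$ iff $X$ is bounded; for an ordinal $\alpha$, $\operatorname{trasInd}X\le\alpha$ if for every two asymptotically disjoint sets $A,B\subset X$ there is an asymptotic separator $C$ for $A$ and $B$ with $\operatorname{trasInd}C\le\beta$ for some $\beta<\alpha$ ($\beta=-1$ allowed). $\operatorname{trasInd}X=\alpha$ if $\operatorname{trasInd}X\le\alpha$ and $\operatorname{trasInd}X\le\beta$ holds for no $\beta<\alpha$; $\operatorname{trasInd}X=\infty$ if $\operatorname{trasInd}X\le\alpha$ holds for no ordinal $\alpha$. *)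

(* Defs.v *)
From HB Require Import structures.
From mathcomp Require Import all_boot all_order all_algebra.
From mathcomp Require Import all_classical all_reals all_analysis.
From mathcomp Require Import wochoice.

Set Implicit Arguments.
Unset Strict Implicit.
Unset Printing Implicit Defensive.

Import Order.TTheory GRing.Theory Num.Theory.
Import numFieldNormedType.Exports.

Local Open Scope classical_set_scope.
Local Open Scope ring_scope.

(* The library equips [set_type A] with the pseudometric induced by the
   inclusion; over a metric space it is the restricted metric. *)
Section subspace_metric.
Context {R : realType} {X : metricType R} (A : set X).

Let sub_mdist (x y : set_type A) : R := mdist (set_val x) (set_val y).

Let sub_mdist_ge0 x y : 0 <= sub_mdist x y.
Proof. exact: mdist_ge0. Qed.

Let sub_mdist_positivity x y : sub_mdist x y = 0 -> x = y.
Proof. by move=> /mdist_positivity/val_inj. Qed.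

Let sub_ballE x d : ball x d = [set y | sub_mdist x y < d].
Proof.
have -> : ball x d = set_val @^-1` (ball (set_val x) d : set X) by [].
by rewrite ballEmdist.
Qed.

HB.instance Definition _ := @PseudoMetric_isMetric.Build R (set_type A)
  sub_mdist sub_mdist_ge0 sub_mdist_positivity sub_ballE.

End subspace_metric.

Section metric_notions.
Context {R : realType} {X : metricType R}.

(* [closed_ball] is the closure of the open ball in the library, which may be
   smaller than the closed ball. *)
Definition proper_metric : Prop :=
  forall (x : X) (r : R), compact [set y | mdist x y <= r].

Definition bounded_metric : Prop :=
  exists M : R, forall x y : X, mdist x y <= M.

(* The argument only witnesses that X is nonempty: [xget x setT] is the same
   point for every x, namely the base point of X. *)
Definition base_point (x : X) : X := xget x setT.

Definition base_ball (r : R) : set X := [set x | mdist (base_point x) x < r].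

(* The infimum of the empty set is +oo. *)
Definition set_dist (A B : set X) : \bar R :=
  ereal_inf [set (mdist a b)%:E | a in A & b in B].

Definition asymptotically_disjoint (A B : set X) : Prop :=
  set_dist (A `\` base_ball r) (B `\` base_ball r) @[r --> +oo] --> +oo%E.

End metric_notions.

Arguments proper_metric {R} X.
Arguments bounded_metric {R} X.

Section Higson.
Context {R : realType}.

Definition unit_interval : topologicalType := set_type (`[0, 1] : set R).

Definition diam (S : set unit_interval) : \bar R :=
  ereal_sup [set (`|set_val a - set_val b|)%:E | a in S & b in S].

Context (X : metricType R).

Definition slowly_oscillating (phi : X -> unit_interval) : Prop :=
  forall r e : R, 0 < r -> 0 < e -> exists2 D : R, 0 < D &
    forall x : X, D <= mdist (base_point x) x ->
      (diam (phi @` ball x r) < e%:E)%E.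

Definition higson_functions : set (X -> unit_interval) :=
  [set phi | continuous phi /\ slowly_oscillating phi].

Definition higson_cube : topologicalType :=
  prod_topology (fun _ : set_type higson_functions => unit_interval).

Definition higson_eval (x : X) : higson_cube := fun phi => set_val phi x.

Definition higson_compactification : topologicalType :=
  set_type (closure (range higson_eval)).

Definition higson_embedding (x : X) : higson_compactification :=
  exist _ (higson_eval x) (mem_set (subset_closure (imageT higson_eval x))).

Definition higson_corona : topologicalType :=
  set_type (~` range higson_embedding).

Definition corona_trace (C : set X) : set higson_corona :=
  set_val @^-1` closure (higson_embedding @` C).

End Higson.

Arguments unit_interval R : clear implicits.
Arguments higson_functions {R} X.

Definition partition_between (T : topologicalType) (F1 F2 P : set T) : Prop :=
  exists U1 U2 : set T, [/\ open U1, open U2, U1 `&` U2 = set0,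
    ~` P = U1 `|` U2 & F1 `<=` U1 /\ F2 `<=` U2].

Definition asymptotic_separator (R : realType) (X : metricType R)
    (A B C : set X) : Prop :=
  closed C /\
  partition_between (corona_trace A) (corona_trace B) (corona_trace C).

(* Values of a dimension function whose finite values other than -1 range
   over O. *)
Variant dim_value (O : Type) : Type :=
  DimMinusOne | DimValue of O | DimInfinity.
Arguments DimMinusOne {O}.
Arguments DimInfinity {O}.

(* asInd X <= n for n >= 0; in the case n = 0 the condition asInd C <= -1 on
   the separator says that C is bounded. *)
Fixpoint asInd_le (R : realType) (n : nat) (X : metricType R) : Prop :=
  forall A B : set X, asymptotically_disjoint A B ->
    exists2 C : set X, asymptotic_separator A B C &
      match n with
      | 0%N => bounded_metric (set_type C)
      | m.+1 => asInd_le m (set_type C)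
      end.

Definition asInd_eq (R : realType) (X : metricType R) (v : dim_value nat) :
    Prop :=
  match v with
  | DimMinusOne => bounded_metric X
  | DimValue n => [/\ ~ bounded_metric X, asInd_le n X &
                      forall m : nat, (m < n)%N -> ~ asInd_le m X]
  | DimInfinity => ~ bounded_metric X /\ forall n : nat, ~ asInd_le n X
  end.

Definition asInd_lt_infinity (R : realType) (X : metricType R) : Prop :=
  exists2 v, asInd_eq X v & v <> DimInfinity.

(* Ordinals are order types of well-ordered sets, represented by well-ordered
   sets; only the comparison [ord_lt] of order types is used. *)
Record ord := Ord {
  ord_disp : Order.disp_t;
  ord_sort :> orderType ord_disp;
  ord_well_order : well_order (<=%O : rel ord_sort) }.

(* a is isomorphic to a proper initial segment of b. *)
Definition ord_lt (a b : ord) : Prop :=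
  exists (f : a -> b) (t : b),
    {mono f : x y / (x < y)%O} /\ range f = [set y | (y < t)%O].

(* trasInd X <= a for an ordinal a. Since [ord_lt] is well founded, this
   inductive predicate is the one defined by recursion on a. *)
Inductive trasInd_le (R : realType) (a : ord) (X : metricType R) : Prop :=
  TrasIndLe of
    forall A B : set X, asymptotically_disjoint A B ->
      exists2 C : set X, asymptotic_separator A B C &
        bounded_metric (set_type C) \/
        exists2 b : ord, ord_lt b a & trasInd_le b (set_type C).

Definition trasInd_eq (R : realType) (X : metricType R) (v : dim_value ord) :
    Prop :=
  match v with
  | DimMinusOne => bounded_metric X
  | DimValue a => [/\ ~ bounded_metric X, trasInd_le a X &
                      forall b : ord, ord_lt b a -> ~ trasInd_le b X]
  | DimInfinity => ~ bounded_metric X /\ forall a : ord, ~ trasInd_le a X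
  end.

Definition trasInd_lt_infinity (R : realType) (X : metricType R) : Prop :=
  exists2 v, trasInd_eq X v & v <> DimInfinity.

(* Main.v *)
Require Import Defs.
From mathcomp Require Import all_boot all_order all_algebra.
From mathcomp Require Import all_classical all_reals all_analysis.
From mathcomp Require Import ring lra zify.

(* The assertion that a sequence of bounded blocks running to infinity in X has
   dimension less than n can be made finitary: there is a growth function g such
   that, for each i, all but finitely many blocks satisfy a condition depending
   only on n and on the values of g up to i. There are countably many such data
   (n, g restricted to [0, i]), and all those that fail at infinitely many blocks
   can be defeated by a single pair of asymptotically disjoint sets A and B,
   chosen diagonally. If A and B have a separator of finite dimension, its n and
   g are not defeated, hence serve all pairs of sets at once. By induction on the
   ordinal, trasInd X < oo bounds the dimension of each sequence of blocks of X.
   Since X is the union of two such sequences, the even and the odd shells around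
   a point, asInd X is bounded by a sum theorem, proved like the inequality
   Ind (X1 u X2) <= Ind X1 + Ind X2 + 1 for closed subsets of normal spaces. *)

Set Implicit Arguments.
Unset Strict Implicit.
Unset Printing Implicit Defensive.

Import Order.TTheory GRing.Theory Num.Theory.
Import numFieldNormedType.Exports.

Local Open Scope classical_set_scope.
Local Open Scope ring_scope.

(** * Coarse geometry *)

(** The separator may vary with the pair of sets, and the dimensions of the separators of different
    pairs have no common bound a priori. Diagonalization against all of them needs countably many
    conditions, each concerning bounded sets only. This is why separation in the corona is restated
    with chains, in which a step of length s is allowed only at distance more than g(s) from C. One
    set V has to withstand the steps of all lengths below i together: the sum theorem builds a side
    of its separator from a single V per block and then tests it against every step length. Blocks
    that drift apart do not interact, so failures on different blocks can be assembled into one pair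
    A, B, and a separator of that pair can be examined block by block. *)

Section coarse.
Context {R : realType} {X : metricType R}.
Implicit Types (x y z : X) (A B C D E S T V Z : set X) (g : nat -> nat).

(** Quantifying over all centres avoids a base point and makes sense in the empty space; by [bnd_le]
    one centre is enough. *)
Definition bnd S :=
  forall x, exists M : nat, forall y, S y -> mdist x y <= M%:R.

Definition near_part (r : nat) A B : set X :=
  [set a | A a /\ exists2 b, B b & mdist a b <= r%:R].

Definition asym_disj A B := forall r, bnd (near_part r A B).

Definition far (t : nat) C x := forall c, C c -> t%:R < mdist x c.

Lemma natr_ge (r : R) : exists n : nat, r <= n%:R.
Proof.
exists (Num.bound r); have [r0|r0] := leP 0 r.
  by rewrite (le_trans _ (ltW (archi_boundP r0))).
by rewrite (le_trans (ltW r0)).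
Qed.

Lemma bnd_le S x (r : R) : (forall y, S y -> mdist x y <= r) -> bnd S.
Proof.
move=> H z; have [n rn] := natr_ge (mdist z x + r); exists n => y /H xy.
have := metric_triangle z x y; lra.
Qed.

Lemma sub_bnd S T : S `<=` T -> bnd T -> bnd S.
Proof. by move=> ST bT x; have [M H] := bT x; exists M => y /ST; exact: H. Qed.

Lemma bnd0 : bnd set0. Proof. by move=> x; exists 0%N. Qed.

Lemma bndU S T : bnd S -> bnd T -> bnd (S `|` T).
Proof.
move=> bS bT x; have [M HM] := bS x; have [N HN] := bT x.
exists (M + N)%N => y [/HM|/HN]; rewrite natrD;
  have := ler0n R M; have := ler0n R N; lra.
Qed.

Lemma bnd_bigU (F : nat -> set X) n : (forall k, (k < n)%N -> bnd (F k)) ->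
  bnd [set x | exists2 k, (k < n)%N & F k x].
Proof.
elim: n => [|n IH] bF; first by apply: sub_bnd bnd0 => x [].
apply: sub_bnd (bndU (IH (fun k kn => bF k (ltnW kn))) (bF n (ltnSn n))).
move=> x [k]; rewrite ltnS leq_eqVlt => /predU1P[->|kn] Fx; first by right.
by left; exists k.
Qed.

Lemma bnd_nbhd S (r : nat) : bnd S ->
  bnd [set x | exists2 y, S y & mdist x y <= r%:R].
Proof.
move=> bS x; have [M HM] := bS x; exists (M + r)%N => y [z /HM xz yz].
have := metric_triangle x z y; rewrite (metric_sym z y) natrD; lra.
Qed.

Lemma asym_disj_sub A B A' B' : A' `<=` A -> B' `<=` B ->
  asym_disj A B -> asym_disj A' B'.
Proof.
move=> AA BB H r; apply: sub_bnd (H r) => a [/AA Aa [b /BB Bb ab]].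
by split=> //; exists b.
Qed.

Lemma asym_disjC A B : asym_disj A B -> asym_disj B A.
Proof.
move=> H r; apply: sub_bnd (bnd_nbhd r (H r)) => b [Bb [a Aa ba]].
by exists a => //; split=> //; exists b => //; rewrite metric_sym.
Qed.

Lemma asym_disj_bnd A B : bnd A -> asym_disj A B.
Proof. by move=> bA r; apply: sub_bnd bA => a []. Qed.

Lemma asym_disjUl A A' B : asym_disj A B -> asym_disj A' B ->
  asym_disj (A `|` A') B.
Proof.
move=> H H' r; apply: sub_bnd (bndU (H r) (H' r)) => a [[Aa|Aa] ab].
  by left; split.
by right; split.
Qed.

Lemma asym_disjUr A B B' : asym_disj A B -> asym_disj A B' ->
  asym_disj A (B `|` B').
Proof.
by move=> /asym_disjC H /asym_disjC H'; exact/asym_disjC/asym_disjUl.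
Qed.

Lemma asym_disjI A B : asym_disj A B -> bnd (A `&` B).
Proof.
move=> H; apply: sub_bnd (H 0%N) => x [Ax Bx]; split=> //.
by exists x => //; rewrite mdistxx.
Qed.

(** Metric form of normality: [O] collects the points at least three times closer to some point of
    [A] than to [B]. A point outside [O] within r of a in [A] puts a within 4r of [B]; a point of
    [O] within r of [B] is within r of a point of [A] that is 2r-close to [B]. *)
Lemma asym_disj_interp A B : asym_disj A B ->
  exists O, asym_disj A (~` O) /\ asym_disj O B.
Proof.
move=> AB; exists [set x | exists2 a, A a &
  forall b, B b -> 3 * mdist x a <= mdist x b]; split=> r.
- apply: sub_bnd (AB (4 * r)%N) => a [Aa [x /= nO ax]]; split=> //.
  apply: contrapT => nb; apply: nO; exists a => // b Bb.
  rewrite leNgt; apply/negP => H; apply: nb; exists b => //.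
  rewrite natrM; have := metric_triangle a x b; have := metric_sym a x; lra.
- apply: sub_bnd (bnd_nbhd r (AB (2 * r)%N)) => x [[a Aa H] [b Bb xb]].
  have xa := H b Bb; have := mdist_ge0 x a => x0.
  exists a; last by lra.
  split=> //; exists b => //.
  rewrite natrM; have := metric_triangle a x b; have := metric_sym a x; lra.
Qed.

Definition step_closed i g D C V := forall s x y, (s < i)%N ->
  D x -> D y -> far (g s) C x -> far (g s) C y -> mdist x y <= s%:R -> V x -> V y.

(* A chain of steps from A to B, where a step between points of D at distance
   more than [g s] from C may have length s, is ruled out by a set V that no
   step leaves. *)
Definition mixsep i g D A B C :=
  exists V, [/\ D `&` A `<=` V, D `&` B `<=` ~` V & step_closed i g D C V].

Lemma mixsep_mono i i' g g' D D' A A' B B' C C' : (i' <= i)%N ->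
  (forall s, (s < i')%N -> forall x, D' x -> far (g' s) C' x -> far (g s) C x) ->
  D' `<=` D -> A' `<=` A -> B' `<=` B ->
  mixsep i g D A B C -> mixsep i' g' D' A' B' C'.
Proof.
move=> ii gg DD AA BB [V [AV BV HV]]; exists V; split.
- by move=> x [/DD Dx /AA Ax]; exact: AV.
- by move=> x [/DD Dx /BB Bx]; exact: BV.
- move=> s x y si Dx Dy /(gg _ si _ Dx) fx /(gg _ si _ Dy) fy.
  by apply: (HV s) fx fy; [exact: leq_trans ii|exact: DD|exact: DD].
Qed.

Lemma far_le t t' C C' x : (t <= t')%N -> C `<=` C' -> far t' C' x -> far t C x.
Proof.
by move=> tt CC H c /CC /H; apply: le_lt_trans; rewrite ler_nat.
Qed.

Definition blocks (Z : nat -> set X) := (forall k, bnd (Z k)) /\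
  forall M : nat, exists K, forall k l, (K <= k)%N -> k <> l ->
    forall x y, Z k x -> Z l y -> M%:R < mdist x y.

(** Two blocks meeting [S] have points at distance at most the diameter of [S], which is impossible
    once one of their indices is large. *)
Lemma blocks_far (Z : nat -> set X) S : blocks Z -> bnd S ->
  exists K, forall k, (K <= k)%N -> forall x, Z k x -> ~ S x.
Proof.
move=> [bZ HZ] bS.
have [[s Ss]|nS] := pselect (exists s, S s); last first.
  by exists 0%N => k _ x _ Sx; apply: nS; exists x.
have [M HM] := bS s; have [K HK] := HZ (M + M)%N.
have [[k [Kk [x Zx Sx]]]|nk] :=
  pselect (exists k, (K <= k)%N /\ exists2 x, Z k x & S x); last first.
  by exists K => k Kk x Zx Sx; apply: nk; exists k; split=> //; exists x.
exists k.+1 => l kl y Zy Sy.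
have lk : k <> l by move=> e; rewrite e ltnn in kl.
have := HK k l Kk lk x y Zx Zy; have := HM _ Sx; have := HM _ Sy.
have := metric_triangle x s y; rewrite (metric_sym x s) natrD; lra.
Qed.

Lemma sub_blocks (Z Z' : nat -> set X) : (forall k, Z' k `<=` Z k) ->
  blocks Z -> blocks Z'.
Proof.
move=> ZZ [bZ HZ]; split=> [k|M]; first exact: sub_bnd (bZ k).
have [K HK] := HZ M; exists K => k l Kk kl x y /ZZ Zx /ZZ Zy; exact: HK Zx Zy.
Qed.

End coarse.

Lemma blocks_comp (R : realType) (X : metricType R) (Z : nat -> set X)
    (m : nat -> nat) : (forall k, m k < m k.+1)%N ->
  blocks Z -> blocks (Z \o m).
Proof.
move=> mm [bZ HZ]; split=> [k|M]; first exact: bZ.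
have mi : {homo m : i j / (i < j)%N} by apply: homo_ltn => //; exact: ltn_trans.
have mk k : (k <= m k)%N.
  by elim: k => // k IH; exact: leq_ltn_trans IH (mm k).
have [K HK] := HZ M; exists K => k l Kk kl; apply: HK.
  exact: leq_trans (mk k).
move=> e; have [kl'|kl'|//] := ltngtP k l; have := mi _ _ kl';
  by rewrite e ltnn.
Qed.

(** * Finitary approximations of dimension *)

Section uniform_dimension.
Context {R : realType}.

(* [dim_approx n i g Z] is a finitary and hereditary approximation of the
   assertion that the dimension of a sequence of blocks is less than n: larger i
   means a more precise approximation, and g records the growth of all the
   constants. *)
Fixpoint dim_approx (X : metricType R) (n i : nat) (g : nat -> nat)
    (Z : set X) : Prop :=
  if n is n'.+1 then
    forall j (D A B : set X), (j <= i)%N -> D `<=` Z -> A `<=` D -> B `<=` D ->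
      (forall a b, A a -> B b -> (g j)%:R <= mdist a b) ->
      exists C, [/\ C `<=` D, C `&` A = set0, C `&` B = set0,
        mixsep j g D A B C & dim_approx n' j g C]
  else Z = set0.

(** A larger [g] weakens the condition twice: the sets to be separated are farther apart, and chains
    must stay farther from the separator. Only the values of [g] up to the precision matter, so the
    data are countable. *)
Lemma dim_approx_mono (X : metricType R) n i i' g g' (Z Z' : set X) : (i' <= i)%N ->
  (forall s, (s <= i')%N -> (g s <= g' s)%N) -> Z' `<=` Z ->
  dim_approx n i g Z -> dim_approx n i' g' Z'.
Proof.
elim: n i i' Z Z' => [|n IH] i i' Z Z' ii gg ZZ /=.
  by move=> Z0; apply/seteqP; split=> // x /ZZ; rewrite Z0.
move=> H j D A B ji DZ AD BD dAB.
have gj s : (s <= j)%N -> (g s <= g' s)%N by move=> sj; apply/gg/(leq_trans sj).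
have [|C [CD CA CB CS CQ]] := H j D A B (leq_trans ji ii)
  (subset_trans DZ ZZ) AD BD.
  by move=> a b Aa Bb; rewrite (le_trans _ (dAB a b Aa Bb))// ler_nat gj.
exists C; split=> //.
  apply: mixsep_mono CS => // s sj x _; apply: far_le => //.
  exact/gj/ltnW.
exact: IH CQ.
Qed.

(** The separator is pulled back along [h]. A step of length s becomes one of length at most 2s,
    which doubles [i] and the argument of [g]; the outer factor 2 compensates for distances that [h]
    halves. *)
Lemma dim_approx_bilip (X X' : metricType R) (h : X -> X') n i g (Z : set X)
    (Z' : set X') :
  (forall x, Z x -> Z' (h x)) ->
  (forall x y, Z x -> Z y -> mdist (h x) (h y) <= 2 * mdist x y) ->
  (forall x y, Z x -> Z y -> mdist x y <= 2 * mdist (h x) (h y)) ->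
  dim_approx n (2 * i) g Z' -> dim_approx n i (fun s => 2 * g (2 * s))%N Z.
Proof.
elim: n i Z Z' => [|n IH] i Z Z' ZZ h1 h2 /=.
  by move=> Z0; apply/seteqP; split=> // x /ZZ; rewrite Z0.
move=> H j D A B ji DZ AD BD dAB.
have [||||a b|C [CD CA CB [V [AV BV HV]] CQ]] :=
  H (2 * j)%N (h @` D) (h @` A) (h @` B).
- by rewrite leq_mul2l ji orbT.
- by move=> _ [x /DZ/ZZ Zx <-].
- exact: image_subset.
- exact: image_subset.
- move=> [x Ax <-] [y By <-]; have := dAB _ _ Ax By.
  have := h2 _ _ (DZ _ (AD _ Ax)) (DZ _ (BD _ By)); rewrite natrM; lra.
exists [set x | D x /\ C (h x)]; split.
- by move=> x [].
- apply/seteqP; split=> // x [[Dx Cx] Ax].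
  have : (C `&` (h @` A)) (h x) by split=> //; exists x.
  by rewrite CA.
- apply/seteqP; split=> // x [[Dx Cx] Bx].
  have : (C `&` (h @` B)) (h x) by split=> //; exists x.
  by rewrite CB.
- exists (h @^-1` V); split.
  + by move=> x [Dx Ax]; apply: AV; split; exists x.
  + by move=> x [Dx Bx]; apply: BV; split; exists x.
  + move=> s x y sj Dx Dy fx fy xy; apply: (HV (2 * s)%N); try by exists x.
    * by rewrite ltn_mul2l.
    * by exists y.
    * move=> w Cw; have [c Dc cw] := CD _ Cw; rewrite -cw in Cw *.
      have := fx c (conj Dc Cw); have := h2 _ _ (DZ _ Dx) (DZ _ Dc).
      rewrite natrM; lra.
    * move=> w Cw; have [c Dc cw] := CD _ Cw; rewrite -cw in Cw *.
      have := fy c (conj Dc Cw); have := h2 _ _ (DZ _ Dy) (DZ _ Dc).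
      rewrite natrM; lra.
    * have := h1 _ _ (DZ _ Dx) (DZ _ Dy); rewrite natrM; lra.
- apply: IH CQ => [x []//|x y [Dx _] [Dy _]|x y [Dx _] [Dy _]].
    exact: h1 (DZ _ Dx) (DZ _ Dy).
  exact: h2 (DZ _ Dx) (DZ _ Dy).
Qed.

End uniform_dimension.

(** * Nets and pullbacks of separators *)

Lemma maximal_pairwise (T : Type) (r : T -> T -> Prop) (S P : set T) :
  (forall x y, r x y -> r y x) ->
  (forall x y, S x -> S y -> x <> y -> r x y) ->
  exists N, [/\ S `<=` N, N `<=` S `|` P,
    forall x y, N x -> N y -> x <> y -> r x y &
    forall x, P x -> N x \/ exists2 y, N y & ~ r x y].
Proof.
(* [A] is the part added to [S], so that the union of the empty chain is good as well. *)
move=> rC rS; pose good A := A `<=` P /\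
  forall x y, (S `|` A) x -> (S `|` A) y -> x <> y -> r x y.
have [F Fgood Ftot|A [[AP rA] Amax]] := @Zorn_bigcup _ good.
  split=> [x [A /Fgood[AP _] /AP]//|x y [Sx|[A FA Ax]] [Sy|[B FB By]]].
  - exact: rS.
  - by move=> xy; apply: (Fgood _ FB).2 => //; [left|right].
  - by move=> xy; apply: (Fgood _ FA).2 => //; [right|left].
  - have [AB|BA] := Ftot _ _ FA FB => xy.
      by apply: (Fgood _ FB).2 => //; right=> //; exact: AB.
    by apply: (Fgood _ FA).2 => //; right=> //; exact: BA.
exists (S `|` A); split=> //; first exact: setUS.
move=> x Px; apply: contrapT => /not_orP[nSA nr].
have rx y : (S `|` A) y -> r x y.
  by move=> SAy; apply: contrapT => nxy; apply: nr; exists y.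
apply: (Amax (A `|` [set x])).
  split; first exact: subsetUl.
  by move=> /(_ x (or_intror erefl)) Ax; apply: nSA; right.
split=> [y [/AP//|->//]|y z].
rewrite setUA => -[SAy|->] [SAz|->] //; first exact: rA.
  by move=> _; exact/rC/rx.
by move=> _; exact: rx.
Qed.

Section nets.
Context {R : realType} {X : metricType R}.

(** With the constant 8, moving x by [v x] and y by [v y] changes their distance by at most a
    quarter; hence the bilipschitz constant 2 in [separator_pullback]. *)
Let spread (v : X -> nat) x y : Prop := (8 * maxn (v x) (v y))%:R <= mdist x y.

(* The net is built by increasing values of v, so that every point is close to
   a point of the net at which v is not larger. *)
Lemma graded_net (P : set X) (v : X -> nat) : exists N, [/\ N `<=` P,
  forall x y, N x -> N y -> x <> y -> (8 * maxn (v x) (v y))%:R <= mdist x y &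
  forall x, P x -> exists y, [/\ N y, (v y <= v x)%N &
    mdist x y <= (8 * v x)%:R]].
Proof.
have spC x y : spread v x y -> spread v y x.
  by rewrite /spread maxnC metric_sym.
pose pw (S : set X) := forall x y, S x -> S y -> x <> y -> spread v x y.
(* The premise [pw S] is placed under the existential, so that the recursion [M] can choose before
   its values are known to be spread. *)
have ext (l : nat) (S : set X) : exists N, pw S -> [/\ S `<=` N,
    N `<=` S `|` (P `&` [set x | (v x <= l)%N]), pw N &
    forall x, P x -> (v x <= l)%N -> N x \/ exists2 y, N y & ~ spread v x y].
  have [pS|nS] := pselect (pw S); last by exists set0.
  have [N [N1 N2 N3 N4]] := maximal_pairwise
    (P `&` [set x | (v x <= l)%N]) spC pS.
  by exists N => _; split=> // x Px vx; exact: N4.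
pose M := fix M l := if l is l'.+1 then sval (cid (ext l' (M l'))) else set0.
have MS l : pw (M l) -> _ := svalP (cid (ext l (M l))).
have pM l : pw (M l) by elim: l => [x y []|l /MS[]].
have ML l l' : (l <= l')%N -> M l `<=` M l'.
  move=> /subnKC <-; elim: (l' - l)%N => [|k IH]; first by rewrite addn0.
  by rewrite addnS; have [H _ _ _] := MS _ (pM (l + k)%N); exact: subset_trans H.
have MP l : M l `<=` P `&` [set x | (v x < l)%N].
  elim: l => [x []|l IH x]; have [_ H _ _] := MS _ (pM l).
  by move=> /H[/IH[Px vx]|[Px vx]]; split=> //; rewrite /= ltnS ltnW.
exists (\bigcup_l M l); split=> [x [l _ /MP[]]//|x y [l _ Mx] [l' _ My]|x Px].
  apply: (pM (maxn l l')); first exact: ML (leq_maxl _ _) _ Mx.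
  exact: ML (leq_maxr _ _) _ My.
have [_ _ _ /(_ x Px (leqnn _))] := MS _ (pM (v x)).
move=> [Nx|[y Ny]].
  by exists x; split=> //; [exists (v x).+1|rewrite mdistxx].
have [_ vy] := MP (v x).+1 _ Ny; move=> /negP; rewrite -ltNge => xy.
exists y; split; first by exists (v x).+1.
  by rewrite -ltnS.
by rewrite (maxn_idPl _)// in xy; exact: ltW.
Qed.

End nets.

Section pullback.
Context {R : realType} {X : metricType R}.

Definition metric_separator (A B C : set X) := [/\ asym_disj A C, asym_disj B C &
  exists g, forall i, exists2 K, bnd K & mixsep i g (~` K) A B C].

(* Restricting C to the points near Z would thicken it, and hence possibly raise
   its dimension; a net of Z whose density is proportional to the distance to C
   is instead bilipschitz equivalent to a part of C. *)
Lemma separator_pullback (Z A B : nat -> set X) (C : set X) (c0 : set_type C) :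
  blocks Z -> (forall m, A m `<=` Z m) -> (forall m, B m `<=` Z m) ->
  metric_separator (\bigcup_m A m) (\bigcup_m B m) C ->
  exists g (N : nat -> set X) (h : X -> set_type C),
  [/\ forall m, [/\ N m `<=` Z m, N m `&` A m = set0 & N m `&` B m = set0],
    forall m l x y, N m x -> N l y -> mdist (h x) (h y) <= 2 * mdist x y,
    forall m l x y, N m x -> N l y -> mdist x y <= 2 * mdist (h x) (h y) &
    forall i, exists K, forall m, (K <= m)%N ->
      mixsep i g (Z m) (A m) (B m) (N m)].
Proof.
move=> bZ AZ BZ [AC BC [g sepC]].
(* [v x] below is the least natural radius at which [C] is reached, plus one to make it positive;
   [h x] is a point of [C] within [v x]. *)
pose lev x t := `[< exists c : set_type C, mdist x (set_val c) <= t%:R >].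
have levex x : exists t, lev x t.
  have [t xt] := natr_ge (mdist x (set_val c0)); exists t.
  by apply/asboolP; exists c0.
pose v x := (ex_minn (levex x)).+1.
have hex x : exists c : set_type C, mdist x (set_val c) <= (v x)%:R.
  rewrite /v; case: ex_minnP => t /asboolP[c xc] _; exists c.
  by rewrite (le_trans xc)// ler_nat.
pose h x := sval (cid (hex x)).
have hP x : mdist x (set_val (h x)) <= (v x)%:R := svalP (cid (hex x)).
have vmin x c t : C c -> mdist x c <= t%:R -> (v x <= t.+1)%N.
  move=> Cc xc; rewrite /v; case: ex_minnP => u _ /(_ t); rewrite ltnS; apply.
  by apply/asboolP; exists (exist _ c (mem_set Cc)).
pose AB := (\bigcup_m A m) `|` (\bigcup_m B m).
(* Points too close to [A] or [B] are left out, so that the net misses both sets. *)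
pose P := [set x | (exists m, Z m x) /\ forall a, AB a -> (2 * v x)%:R <= mdist x a].
have [N [NP Nsep Ncov]] := graded_net P v.
have N0 x a : N x -> AB a -> x <> a.
  move=> /NP[_ Px] /Px + xa; rewrite xa mdistxx natrM.
  have : (1 : R) <= (v a)%:R by rewrite ler1n.
  lra.
have hd x y : mdist (h x) (h y) = mdist (set_val (h x)) (set_val (h y)) by [].
have lip x y : N x -> N y -> mdist (h x) (h y) <= 2 * mdist x y /\
    mdist x y <= 2 * mdist (h x) (h y).
  move=> Nx Ny; have [->|/eqP xy] := eqVneq x y; first by rewrite !mdistxx; lra.
  have := Nsep _ _ Nx Ny xy; rewrite natrM hd.
  have : (v x)%:R <= (maxn (v x) (v y))%:R :> R by rewrite ler_nat leq_maxl.
  have : (v y)%:R <= (maxn (v x) (v y))%:R :> R by rewrite ler_nat leq_maxr.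
  have := hP x; have := hP y.
  have := metric_triangle x (set_val (h x)) y.
  have := metric_triangle (set_val (h x)) (set_val (h y)) y.
  have := metric_triangle (set_val (h x)) x (set_val (h y)).
  have := metric_triangle x y (set_val (h y)).
  rewrite (metric_sym (set_val (h x)) x) (metric_sym (set_val (h y)) y).
  lra.
(* A point within [g s] of [C] has [v] at most [(g s).+1]; if it lies in [P], the net comes within 8
   times that. *)
exists (fun s => 8 * (g s).+1)%N, (fun m => N `&` Z m), h; split.
- move=> m; split; first exact: subIsetr.
    apply/seteqP; split=> // x [[Nx _] Ax].
    by apply: (N0 _ x Nx) => //; left; exists m.
  apply/seteqP; split=> // x [[Nx _] Bx].
  by apply: (N0 _ x Nx) => //; right; exists m.
- by move=> m l x y [Nx _] [Ny _]; have [] := lip _ _ Nx Ny.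
- by move=> m l x y [Nx _] [Ny _]; have [] := lip _ _ Nx Ny.
move=> i; have [K0 bK0 sepK] := sepC i.
pose T := (\max_(s < i) g s).+1.
have gT s : (s < i)%N -> ((g s).+1 <= T)%N.
  by move=> si; rewrite ltnS (leq_bigmax (Ordinal si)).
have ABC : asym_disj AB C by exact: asym_disjUl.
(* A point of a block outside [P] but within T of [C] is within 2T of some a in [AB], and a is then
   within 4T of [C]. Such points form a bounded set, since [AB] and [C] are asymptotically
   disjoint. *)
pose W := [set x | exists2 a, near_part (4 * T) AB C a & mdist x a <= (2 * T)%:R].
have bW : bnd W by exact/bnd_nbhd/ABC.
have [K1 HK1] := blocks_far bZ (bndU bK0 bW).
have [K2 HK2] := bZ.2 (8 * T)%N.
exists (maxn K1 K2) => m; rewrite geq_max => /andP[mK1 mK2].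
apply: mixsep_mono sepK => //.
- move=> s si x Zx fx c Cc; rewrite ltNge; apply/negP => xc.
  have vx := vmin _ _ _ Cc xc.
  have Px : P x.
    split; first by exists m.
    move=> a ABa; rewrite leNgt; apply/negP => xa.
    apply: (HK1 m mK1 x Zx); right; exists a.
      split=> //; exists c => //.
      have : (v x)%:R <= T%:R :> R by rewrite ler_nat (leq_trans vx)// gT.
      have : (g s)%:R <= T%:R :> R by rewrite ler_nat ltnW// gT.
      have := metric_triangle a x c; rewrite (metric_sym a x).
      have : 0 <= T%:R :> R by [].
      move: xa xc; rewrite !natrM; lra.
    by rewrite (le_trans (ltW xa))// ler_nat leq_mul2l/= (leq_trans vx)// gT.
  have [y [Ny vy xy]] := Ncov _ Px.
  have [[l Zy] _] := NP _ Ny.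
  have ml : m = l.
    apply: contrapT => ml; have := HK2 m l mK2 ml _ _ Zx Zy.
    rewrite ltNge => /negP; apply; rewrite (le_trans xy)// ler_nat leq_mul2l/=.
    by rewrite (leq_trans vx)// gT.
  have := fx y; rewrite ml => /(_ (conj Ny Zy)); rewrite ltNge => /negP; apply.
  by rewrite (le_trans xy)// ler_nat leq_mul2l/= (leq_trans vx).
- by move=> x Zx Kx; apply: (HK1 m mK1 x Zx); left.
- by move=> x Ax; exists m.
- by move=> x Bx; exists m.
Qed.

End pullback.

(** * Uniformization *)

Section uniformization.
Context {R : realType}.

Definition uniformly_finite (X : metricType R) := forall Z : nat -> set X,
  blocks Z -> exists n g, forall i, exists K, forall k, (K <= k)%N ->
    dim_approx n i g (Z k).

Definition splits (X : metricType R) n i g (D A B : set X) :=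
  exists C, [/\ C `<=` D, C `&` A = set0, C `&` B = set0,
    mixsep i g D A B C & dim_approx n i g C].

Lemma splits_mono (X : metricType R) n i g g' (D A B : set X) :
  (forall s, (s <= i)%N -> (g s <= g' s)%N) ->
  splits n i g D A B -> splits n i g' D A B.
Proof.
move=> gg [C [CD CA CB CS CQ]]; exists C; split=> //; last exact: dim_approx_mono CQ.
by apply: mixsep_mono CS => // s si x _; apply: far_le => //; exact/gg/ltnW.
Qed.

(** The exponent of 2 in m takes every value at arbitrarily large m. *)
Lemma enum_infinitely_often (T : countType) :
  exists e : nat -> option T, forall t K, exists2 m, (K <= m)%N & e m = Some t.
Proof.
exists (fun m => unpickle (logn 2 m)) => t K.
exists (2 ^ pickle t * K.*2.+1)%N.
  rewrite -addnn; have : (0 < 2 ^ pickle t)%N by rewrite expn_gt0.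
  nia.
rewrite lognM ?expn_gt0// pfactorK// (@logn_coprime 2) ?addn0 ?pickleK//.
by rewrite coprime2n/= odd_double.
Qed.

(* A node (n, s) is deadly if its data fail on arbitrarily far blocks for pairs of
   sets that are arbitrarily far apart; A and B combine witnesses of infinitely
   many failures of every deadly node. *)
Lemma uniformly_finite_separators (X : metricType R) :
  (forall A B : set X, asym_disj A B ->
    exists2 C, metric_separator A B C & uniformly_finite (set_type C)) ->
  uniformly_finite X.
Proof.
move=> sepX Z bZ.
(* A nonempty list stands for the values of [g] from 0 to i, so i is its size minus one. *)
pose node (t : nat * seq nat) (D A B : set X) :=
  splits t.1 (size t.2).-1 (nth 0%N t.2) D A B.
pose wit t (d K : nat) (q : nat * (set X * set X * set X)) :=
  let: (k, (D, A, B)) := q in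
  [/\ (K <= k)%N, D `<=` Z k, A `<=` D, B `<=` D &
    (forall a b, A a -> B b -> d%:R <= mdist a b) /\ ~ node t D A B].
pose deadly t := forall d K, exists q, wit t d K q.
(* What remains of [wit] at the stages that treat no deadly node; empty sets satisfy it. *)
pose sound (d K : nat) (q : nat * (set X * set X * set X)) :=
  let: (k, (D, A, B)) := q in
  [/\ (K <= k)%N, D `<=` Z k, A `<=` D, B `<=` D &
    forall a b, A a -> B b -> d%:R <= mdist a b].
have [e he] := enum_infinitely_often (nat * seq nat)%type.
have stepex m K : exists q, sound m K q /\
    forall t, e m = Some t -> deadly t -> wit t m K q.
  have [[t [et dt]]|nt] := pselect (exists t, e m = Some t /\ deadly t).
    have [q hq] := dt m K; exists q; split=> [|t'].
      by case: q hq => k [[D A] B] [H1 H2 H3 H4 [H5 _]].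
    by rewrite et => -[<-].
  exists (K, (set0, set0, set0)); split; first by split.
  by move=> t et dt; exfalso; apply: nt; exists t.
(* Stage m starts beyond the block used before it, so that the blocks form a subsequence, and keeps
   [A m] and [B m] at distance m, so that the unions are asymptotically disjoint. *)
pose q := fix q m := if m is m'.+1 then sval (cid (stepex m (q m').1.+1))
  else sval (cid (stepex 0%N 0%N)).
pose lo m := if m is m'.+1 then (q m').1.+1 else 0%N.
have qP m : sound m (lo m) (q m) /\
    forall t, e m = Some t -> deadly t -> wit t m (lo m) (q m).
  by case: m => [|m]; exact: (svalP (cid (stepex _ _))).
pose k m := (q m).1; pose D m := (q m).2.1.1.
pose A m := (q m).2.1.2; pose B m := (q m).2.2.
have qS m : [/\ (lo m <= k m)%N, D m `<=` Z (k m), A m `<=` D m, B m `<=` D m &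
    forall a b, A m a -> B m b -> m%:R <= mdist a b].
  by have [+ _] := qP m; rewrite /k /D /A /B; case: (q m) => ? [[? ?] ?].
have qD m t : e m = Some t -> deadly t -> ~ node t (D m) (A m) (B m).
  move=> et dt; have [_ /(_ t et dt)] := qP m; rewrite /D /A /B.
  by case: (q m) => ? [[? ?] ?] [_ _ _ _ []].
have kk m : (k m < k m.+1)%N by have [] := qS m.+1.
have bD : blocks D.
  by apply: sub_blocks (blocks_comp kk bZ) => m; have [] := qS m.
have AD m : A m `<=` D m by have [] := qS m.
have BD m : B m `<=` D m by have [] := qS m.
have dAB m a b : A m a -> B m b -> m%:R <= mdist a b.
  by have [_ _ _ _] := qS m; exact.
have AB : asym_disj (\bigcup_m A m) (\bigcup_m B m).
  move=> r; have [K HK] := bD.2 r.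
  apply: sub_bnd (@bnd_bigU _ _ D (maxn K r.+1) (fun m _ => bD.1 m)).
  move=> a [[m _ Am] [b [l _ Bl] ab]]; exists m; last exact: AD.
  rewrite ltnNge geq_max; apply/negP => /andP[Km rm].
  have [ml|/eqP ml] := eqVneq m l.
    rewrite -ml in Bl; have := le_trans (dAB _ _ _ Am Bl) ab.
    by rewrite ler_nat leqNgt rm.
  by have := HK m l Km ml _ _ (AD _ _ Am) (BD _ _ Bl); rewrite ltNge ab.
have [C sepC thC] := sepX _ _ AB.
have [n [g [N [NP Nsep NQ]]]] : exists n g (N : nat -> set X),
  [/\ forall m, [/\ N m `<=` D m, N m `&` A m = set0 & N m `&` B m = set0],
    forall i, exists K, forall m, (K <= m)%N ->
      mixsep i g (D m) (A m) (B m) (N m) &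
    forall i, exists K, forall m, (K <= m)%N -> dim_approx n i g (N m)].
  (* If [C] is empty there is no map [h] into it, but then the empty set separates all far
     blocks. *)
  have [[c0 _]|nC] := pselect (exists c : set_type C, True); last first.
    have C0 : C = set0.
      apply/seteqP; split=> // c Cc; apply: nC.
      by exists (exist _ c (mem_set Cc)).
    have [_ _ [g Hg]] := sepC; exists 0%N, g, (fun _ => set0).
    split=> [m|i|i]; first by rewrite !set0I; split.
      have [K0 bK0 sepK] := Hg i; have [K HK] := blocks_far bD bK0.
      exists K => m Km; apply: mixsep_mono sepK => //.
      - by move=> s si x _ _ c; rewrite C0.
      - by move=> x Dx; exact: HK Dx.
      - by move=> x Ax; exists m.
      - by move=> x Bx; exists m.
    by exists 0%N.
  have [g [N [h [NP h1 h2 Nsep]]]] := separator_pullback c0 bD AD BD sepC.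
  pose Z' m : set (set_type C) := h @` N m.
  have bZ' : blocks Z'.
    split=> [m|M].
      have [[x0 Nx0]|nN] := pselect (exists x, N m x); last first.
        by apply: sub_bnd bnd0 => z [x Nx _]; apply: nN; exists x.
      have [M HM] := bD.1 m x0; apply: (@bnd_le _ _ _ (h x0) (2 * M%:R)).
      move=> _ [y Ny <-]; rewrite (le_trans (h1 _ _ _ _ Nx0 Ny))//.
      by rewrite ler_pM2l//; apply: HM; have [+ _ _] := NP m; exact.
    have [K HK] := bD.2 (2 * M)%N; exists K => a b Ka ab _ _ [x Nx <-] [y Ny <-].
    have Dx : D a x by have [+ _ _] := NP a; exact.
    have Dy : D b y by have [+ _ _] := NP b; exact.
    have := HK a b Ka ab x y Dx Dy; have := h2 _ _ _ _ Nx Ny.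
    rewrite natrM; lra.
  have [n [g' Hg']] := thC _ bZ'.
  pose g2 s := maxn (g s) (2 * g' (2 * s))%N.
  exists n, g2, N; split=> // i.
    have [K HK] := Nsep i; exists K => m /HK; apply: mixsep_mono => //.
    by move=> s _ x _; apply: far_le => //; exact: leq_maxl.
  have [K HK] := Hg' (2 * i)%N; exists K => m /HK H.
  apply: (@dim_approx_mono _ _ n i i (fun s => 2 * g' (2 * s))%N g2 (N m)) => //.
    by move=> s _; exact: leq_maxr.
  by apply: dim_approx_bilip H => [x Nx|x y|x y]; [exists x|exact: h1|exact: h2].
(* Were the node given by n and [g] up to i deadly, some late stage m would have made it fail on
   [D m], where [N m] shows that it holds. Not being deadly is a statement about all triples in far
   blocks, whence the uniformity. *)
have live i : exists d K, forall l, (K <= l)%N -> forall D' A' B' : set X,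
    D' `<=` Z l -> A' `<=` D' -> B' `<=` D' ->
    (forall a b, A' a -> B' b -> d%:R <= mdist a b) -> splits n i g D' A' B'.
  pose t := (n, mkseq g i.+1).
  have nodeE D' A' B' : node t D' A' B' <-> splits n i g D' A' B'.
    have -> : node t D' A' B' =
        splits n (size (mkseq g i.+1)).-1 (nth 0%N (mkseq g i.+1)) D' A' B' by [].
    rewrite size_mkseq succnK; split; apply: splits_mono => s si;
      by rewrite nth_mkseq.
  have nd : ~ deadly t.
    move=> dt; have [K1 HK1] := Nsep i; have [K2 HK2] := NQ i.
    have [m] := he t (maxn K1 K2); rewrite geq_max => /andP[m1 m2] /qD/(_ dt).
    apply; apply/nodeE; have [H1 H2 H3] := NP m; exists (N m); split=> //.
      exact: HK1.
    exact: HK2.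
  have [d /existsNP[K HK]] : exists d, ~ forall K, exists q, wit t d K q.
    exact/existsNP.
  exists d, K => l Kl D' A' B' H1 H2 H3 H4; apply/nodeE; apply: contrapT => nn.
  by apply: HK; exists (l, (D', A', B')).
have [d hd] := choice live.
(* The thresholds [d] come after [g]; monotonicity allows merging them into one growth function. *)
exists n.+1, (fun s => maxn (g s) (d s)) => i.
have [K hK] := choice hd.
exists (\max_(j < i.+1) K j) => l Kl j D' A' B' ji H1 H2 H3 H4.
apply: splits_mono (hK j l _ D' A' B' H1 H2 H3 _).
- by move=> s _; exact: leq_maxl.
- by apply: leq_trans Kl; rewrite -ltnS in ji; exact: (leq_bigmax (Ordinal ji)).
- move=> a b Aa Bb; rewrite (le_trans _ (H4 a b Aa Bb))// ler_nat.
  exact: leq_maxr.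
Qed.

End uniformization.

(** * Chains avoiding a separator *)

Section chains.
Context {R : realType} {X : metricType R}.

(** [F] carries a chain from a to b: every set closed under steps inside [F] that contains a
    contains b. If there is none, the points linked to [A] through bounded sets form a separating
    V. *)
Lemma not_mixsep_chain i g (D A B C : set X) : ~ mixsep i g D A B C ->
  exists F a b, [/\ bnd F, F `<=` D, (A a /\ F a), (B b /\ F b) &
    forall V, step_closed i g F C V -> V a -> V b].
Proof.
move=> nsep; pose link a y := exists F : set X, [/\ bnd F, F `<=` D, F a, F y &
  forall V, step_closed i g F C V -> V a -> V y].
apply: contrapT => nF; apply: nsep.
exists [set y | exists a, A a /\ link a y]; split.
- move=> a [Da Aa]; exists a; split=> //; exists [set a]; split=> //.
    by apply: (@bnd_le _ _ _ a 0) => _ ->; rewrite mdistxx.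
  by move=> _ ->.
- move=> b [Db Bb] [a [Aa [F [bF FD Fa Fb HF]]]]; apply: nF.
  by exists F, a, b; split.
- move=> s x y si Dx Dy fx fy xy [a [Aa [F [bF FD Fa Fx HF]]]].
  exists a; split=> //; exists (F `|` [set y]); split.
  + apply: bndU => //.
    by apply: (@bnd_le _ _ _ y 0) => _ ->; rewrite mdistxx.
  + by move=> z [/FD//|->].
  + by left.
  + by right.
  + move=> V HV Va; apply: (HV s x y) => //; [by left|by right|].
    by apply: HF => // s' u v si' Fu Fv; apply: HV => //; left.
Qed.

End chains.

(** [side true] and [side false] abstract from the sets whose trace lies in [U1], respectively [U2],
    for a partition of the corona by the trace of [C]. *)
Section sides.
Context {R : realType} {X : metricType R} (C : set X) (side : bool -> set X -> Prop).
Context (sideU : forall b S T, side b S -> side b T -> side b (S `|` T)).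
Context (side_cover : forall E, asym_disj E C ->
  exists S T, [/\ E = S `|` T, side true S & side false T]).
Context (side_disj : forall S T, side true S -> side false T -> asym_disj S T).
Context (side_asym : forall b S, side b S -> asym_disj S C).

(** Cutting from [A t] the points within t of [C] costs a bounded set and makes the union
    asymptotically disjoint from [C]. The part of that union on the other side meets each [A t] in a
    bounded set. *)
Lemma side_pseudo_union b (A : nat -> set X) : (forall t, side b (A t)) ->
  exists2 S, side b S & forall t, bnd (A t `\` S).
Proof.
move=> sA; pose E := [set x | exists2 t, A t x & far t C x].
have EC : asym_disj E C.
  move=> r; apply: sub_bnd (@bnd_bigU _ _ (fun t => near_part r (A t) C) r _).
    move=> x [[t Ax fx] [c Cc xc]]; exists t; last by split=> //; exists c.
    by rewrite -(ltr_nat R); exact: lt_le_trans (fx c Cc) xc.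
  by move=> t _; exact: side_asym (sA t) r.
have AE t : bnd (A t `\` E).
  apply: sub_bnd (side_asym (sA t) t) => x [Ax nE]; split=> //.
  apply: contrapT => nx; apply: nE; exists t => // c Cc.
  by rewrite ltNge; apply/negP => xc; apply: nx; exists c.
have [S [T [EST sS sT]]] := side_cover EC.
case: b sA => sA; [exists S => // t|exists T => // t].
  apply: sub_bnd (bndU (AE t) (asym_disjI (side_disj (sA t) sT))).
  move=> x [Ax nS]; have [Ex|nE] := pselect (E x); last by left.
  by right; split=> //; move: Ex; rewrite EST => -[].
apply: sub_bnd (bndU (AE t) (asym_disjI (asym_disjC (side_disj sS (sA t))))).
move=> x [Ax nT]; have [Ex|nE] := pselect (E x); last by left.
by right; split=> //; move: Ex; rewrite EST => -[].
Qed.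

(** One [g] serves all pairs; only the bounded exceptional set depends on the pair. *)
Definition all_separated i g := forall S T, side true S -> side false T ->
  exists2 K, bnd K & mixsep i g (~` K) S T C.

Lemma all_separated_ext i g g' : (forall s, (s < i)%N -> g s = g' s) ->
  all_separated i g -> all_separated i g'.
Proof.
move=> gg H S T sS sT; have [K bK sepK] := H S T sS sT; exists K => //.
by apply: mixsep_mono sepK => // s si x _; rewrite gg.
Qed.

(* If every threshold t fails at scale i, pick for each t a chain joining the
   two sides; the points at distance more than t from C in the t-th chain are
   divided between the two sides, so that the i-steps of the chain do not
   change sides and the shorter ones do not by induction. *)
Lemma all_separatedS (x0 : X) i g : all_separated i g ->
  exists t, all_separated i.+1 (fun s => if s == i then t else g s).
Proof.
move=> sepg; apply: contrapT => /forallNP nsep.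
pose gt (t : nat) s := if s == i then t else g s.
have {nsep} /choice[AB HAB] t : exists AB : set X * set X,
    [/\ side true AB.1, side false AB.2 &
    forall K, bnd K -> ~ mixsep i.+1 (gt t) (~` K) AB.1 AB.2 C].
  have /existsNP[A /existsNP[B /not_implyP[sA /not_implyP[sB nK]]]] := nsep t.
  by exists (A, B); split=> // K bK sepK; apply: nK; exists K.
have sA t : side true (AB t).1 by have [] := HAB t.
have sB t : side false (AB t).2 by have [] := HAB t.
have [S sS bS] := side_pseudo_union sA.
have [T sT bT] := side_pseudo_union sB.
(* Removing the ball drives the t-th chain to infinity; removing the exceptions makes it start in
   [S] and end in [T]. *)
pose K t := [set x | mdist x0 x <= t%:R] `|`
  (((AB t).1 `\` S) `|` ((AB t).2 `\` T)).
have bK t : bnd (K t).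
  by apply: bndU; [apply: (@bnd_le _ _ _ x0 t%:R)|exact: bndU].
have /choice[F HF] t : exists F : set X, [/\ bnd F, F `<=` ~` K t &
    exists a b, [/\ S a, F a, T b, F b &
      forall V, step_closed i.+1 (gt t) F C V -> V a -> V b]].
  have [_ _ /(_ _ (bK t)) /not_mixsep_chain] := HAB t.
  move=> [F [a [b [bF FK [Aa Fa] [Bb Fb] HF]]]]; exists F; split=> //.
  exists a, b; split=> //; apply: contrapT => nS.
    by apply: (FK a Fa); right; left.
  by apply: (FK b Fb); right; right.
pose E := [set x | exists2 t, F t x & far t C x].
have EC : asym_disj E C.
  move=> r; apply: sub_bnd (@bnd_bigU _ _ F r _).
    move=> x [[t Fx fx] [c Cc xc]]; exists t => //.
    by rewrite -(ltr_nat R); exact: lt_le_trans (fx c Cc) xc.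
  by move=> t _; have [] := HF t.
have [E1 [E2 [EE sE1 sE2]]] := side_cover EC.
have [K0 bK0 [V [V1 V2 HV]]] := sepg _ _ (sideU sS sE1) (sideU sT sE2).
have E12 := side_disj sE1 sE2.
(* The t-th chain avoids the ball of radius t, hence [K0] and all points of [E1] within i of
   [E2]. *)
have [t Ht] := bndU bK0 (E12 i) x0.
have [_ FK [a [b [Sa Fa Tb Fb chain]]]] := HF t.
have nK0 x : F t x -> ~ (K0 `|` near_part i E1 E2) x.
  by move=> /FK nK /Ht xt; apply: nK; left.
have nK0' x : F t x -> ~ K0 x by move=> /nK0 h k; apply: h; left.
apply: (V2 b); first by split; [exact: nK0'|left].
apply: chain; last by apply: V1; split; [exact: nK0'|left].
move=> s x y; rewrite ltnS leq_eqVlt /gt => /predU1P[->|si] Fx Fy.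
  rewrite eqxx => fx fy xy Vx.
  have [[E1x|E2x] Ey] : (E1 `|` E2) x /\ (E1 `|` E2) y.
    by rewrite -EE; split; exists t.
    apply: V1; split; first exact: nK0'.
    right; case: Ey => // E2y; exfalso; apply: (nK0 x Fx); right; split=> //.
    by exists y.
  by exfalso; apply: (V2 x) => //; split; [exact: nK0'|right].
rewrite ltn_eqF// => fx fy xy; apply: HV fx fy xy => //; exact: nK0'.
Qed.

(** Each application of [all_separatedS] fixes one more value of [g] and keeps the earlier ones. At
    scale 0 there are no steps, and [S] itself separates off the bounded set where it meets [T]. *)
Lemma all_separated_exists : exists g, forall i, all_separated i g.
Proof.
have [[x0 _]|nX] := pselect (exists x : X, True); last first.
  exists (fun=> 0%N) => i S T _ _; exists set0; first exact: bnd0.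
  by exists set0; split=> [x|x|s x]; exfalso; apply: nX; exists x.
have sepS i g : exists t, all_separated i g ->
    all_separated i.+1 (fun s => if s == i then t else g s).
  have [sep|nsep] := pselect (all_separated i g); last by exists 0%N.
  by have [t Ht] := all_separatedS x0 sep; exists t.
pose gs := fix gs i := if i is j.+1 then
  fun s => if s == j then sval (cid (sepS j (gs j))) else gs j s else fun=> 0%N.
have Hgs i : all_separated i (gs i).
  elim: i => [S T sS sT|i IH]; last exact: (svalP (cid (sepS i (gs i)))).
  exists (S `&` T); first exact: asym_disjI (side_disj sS sT).
  exists S; split=> [x []//|x [nST Tx] Sx|//]; exact: nST.
have gsE i s : (s < i)%N -> gs i s = gs s.+1 s.
  elim: i => // i IH; rewrite ltnS leq_eqVlt => /predU1P[->//|si].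
  by rewrite -IH//= ltn_eqF.
by exists (fun s => gs s.+1 s) => i; apply: all_separated_ext (Hgs i) => s /gsE.
Qed.

End sides.

(** * The Higson corona *)

Lemma base_point_cst (R : realType) (X : metricType R) (x y : X) :
  base_point x = base_point y.
Proof.
by rewrite /base_point /xget; case: pselect => //= -[]; exists x; exact/asboolP.
Qed.

Lemma asym_disjP (R : realType) (X : metricType R) (A B : set X) :
  asymptotically_disjoint A B <-> asym_disj A B.
Proof.
have bp := @base_point_cst R X.
split=> [/cvgeyPge AB r x|AB].
  have [M [_ HM]] := AB (r%:R + 1); have [n Mn] := natr_ge M.
  apply: (@bnd_le _ _ _ (base_point x) (n%:R + 1 + r%:R)) => a [Aa [b Bb ab]].
  rewrite leNgt; apply/negP => xa.
  have /HM : M < n%:R + 1 by lra.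
  move=> /ereal_infP/(_ (mdist a b)%:E); rewrite lee_fin => H.
  have : r%:R + 1 <= mdist a b; last by lra.
  apply: H; exists a; first split=> //=.
    by rewrite /base_ball/= (bp a x) => h; have := ler0n R r; lra.
  exists b => //; split=> //=; rewrite /base_ball/= (bp b x) => h.
  have := metric_triangle (base_point x) b a; rewrite (metric_sym b a); lra.
apply/cvgeyPge => M; have [n Mn] := natr_ge M.
have [[x0 _]|nX] := pselect (exists x : X, True); last first.
  by near=> r; apply/ereal_infP => y [a]; exfalso; apply: nX; exists a.
have [m Hm] := AB n (base_point x0).
near=> r; apply/ereal_infP => _ [a [Aa ra] [b [Bb rb] <-]]; rewrite lee_fin.
rewrite leNgt; apply/negP => ab; apply: ra; rewrite /base_ball/= (bp a x0).
have : mdist (base_point x0) a <= m%:R.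
  by apply: Hm; split=> //; exists b => //; lra.
move=> /le_lt_trans; apply; near: r; exact: nbhs_pinfty_gt.
Unshelve. all: by end_near.
Qed.

Section set_type_topology.
Context {T : topologicalType} (A : set T).

Lemma set_val_continuous : continuous (set_val : set_type A -> T).
Proof. exact: initial_continuous. Qed.

Lemma compact_set_type (K : set T) : compact (A `&` K) ->
  compact (set_val @^-1` K : set (set_type A)).
Proof.
move=> cK F FF FK.
have [|p [[Ap Kp] clp]] := cK (set_val @ F) (fmap_proper_filter _ FF).
  suff : F (set_val @^-1` (A `&` K)) by [].
  by apply: (@filterS _ F _ (set_val @^-1` K)) => // x Kx; split=> //; exact: set_valP.
exists (exist _ p (mem_set Ap)); split=> // U V FU nV.
have [W [[G oG GW] Wq WV]] := nV.
rewrite -GW in Wq WV.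
have nG : nbhs p G by apply: open_nbhs_nbhs.
have FU' : (set_val @ F) (set_val @` U).
  suff : F (set_val @^-1` (set_val @` U)) by [].
  by apply: filterS FU => x Ux; exists x.
have [y [[x Ux xy] Gy]] := clp _ _ FU' nG.
by exists x; split=> //; apply: WV; rewrite /= xy.
Qed.

Lemma hausdorff_set_type : hausdorff_space T -> hausdorff_space (set_type A).
Proof.
move=> hT p q pq; apply: val_inj; apply: hT => U V Up Vq.
have [x [Ux Vx]] := pq _ _ (set_val_continuous Up) (set_val_continuous Vq).
by exists (set_val x).
Qed.

End set_type_topology.

Section compactification.
Context {R : realType} (X : metricType R).
Local Notation cX := (higson_compactification X).
Local Notation emb := (@higson_embedding R X).

Definition higson_coord (phi : set_type (higson_functions X)) (z : cX) : R :=
  set_val ((set_val z : higson_cube X) phi).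

Lemma higson_coord_continuous phi : continuous (higson_coord phi).
Proof.
have c1 : continuous (set_val : cX -> higson_cube X).
  exact: (@set_val_continuous (higson_cube X)).
have c2 := @proj_continuous _ (fun=> unit_interval R) phi.
have c3 : continuous (set_val : unit_interval R -> R).
  exact: (@set_val_continuous R).
move=> z; apply: (continuous_comp _ (c3 _)).
exact: (continuous_comp (c1 _) (c2 _)).
Qed.

Lemma higson_coord_inj (z z' : cX) :
  (forall phi, higson_coord phi z = higson_coord phi z') -> z = z'.
Proof. by move=> zz; apply: val_inj; apply: funext => phi; exact/val_inj/zz. Qed.

Lemma hausdorff_higson : hausdorff_space cX.
Proof.
have hI : hausdorff_space (unit_interval R).
  exact: (@hausdorff_set_type R `[0, 1] (@Rhausdorff R)).
have hC : hausdorff_space (higson_cube X).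
  exact: (@hausdorff_product _ (fun=> unit_interval R) (fun=> hI)).
exact: (@hausdorff_set_type _ _ hC).
Qed.

Lemma compact_higson : compact [set: cX].
Proof.
have cI : compact [set: unit_interval R].
  have h : compact (`[0, 1] `&` setT : set R).
    by rewrite setIT; exact: segment_compact.
  exact: compact_set_type h.
have cC : compact [set: higson_cube X].
  have e : [set: higson_cube X] = [set f | forall phi, [set: unit_interval R] (f phi)].
    exact/seteqP.
  by rewrite e; exact: (@tychonoff _ (fun=> unit_interval R) (fun=> setT) (fun=> cI)).
have h : compact (closure (range (@higson_eval R X)) `&` setT).
  rewrite setIT; apply: (subclosed_compact _ cC) => //; exact: closed_closure.
exact: compact_set_type h.
Qed.

End compactification.

Section higson_functions.
Context {R : realType} (X : metricType R).

Lemma lipschitz_continuous (f : X -> R) (L : R) :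
  (forall x y, `|f x - f y| <= L * mdist x y) -> continuous f.
Proof.
move=> fL x; apply/cvgrPdist_lt => e e0.
have L1 : 0 < `|L| + 1 by rewrite ltr_wpDl.
have : nbhs x (ball x (e / (`|L| + 1))) by apply: nbhsx_ballx; rewrite divr_gt0.
apply: filterS => y; rewrite ballEmdist /= ltr_pdivlMr// => xy.
apply: le_lt_trans (fL x y) _; apply: le_lt_trans xy.
rewrite mulrC ler_wpM2l ?mdist_ge0//.
have := ler_norm L; lra.
Qed.

Lemma higson_function (f : X -> R) (L : R) : (forall x, 0 <= f x <= 1) ->
  (forall x y, `|f x - f y| <= L * mdist x y) ->
  (forall (r : nat) (e : R), 0 < e -> exists2 K : set X, bnd K &
    forall x y, ~ K x -> mdist x y <= r%:R -> `|f x - f y| <= e) ->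
  exists phi : set_type (higson_functions X),
    forall x, set_val (set_val phi x) = f x.
Proof.
move=> f01 /lipschitz_continuous fc fo.
have fI x : f x \in `[0, 1]%classic by rewrite inE/= in_itv/=.
pose phi x : unit_interval R := exist _ (f x) (fI x).
suff H : higson_functions X phi by exists (exist _ phi (mem_set H)).
split.
  move=> x U [W [[G oG GW] Wx WU]]; rewrite -GW in Wx WU.
  have nG : nbhs (f x) G by apply: open_nbhs_nbhs.
  have fG : nbhs x (f @^-1` G) := fc x _ nG.
  suff : nbhs x (phi @^-1` U) by [].
  by apply: filterS fG => y Gy; apply: WU.
move=> r e r0 e0; have [n rn] := natr_ge r.
(* Oscillation e/4 around the centre gives diameter at most e/2, leaving room for the strict
   inequality. *)
have e4 : 0 < e / 4 by lra.
have [K bK HK] := fo n _ e4.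
have bp := @base_point_cst R X.
have [[x0 _]|nX] := pselect (exists x : X, True); last first.
  by exists 1 => // x; exfalso; apply: nX; exists x.
have [M HM] := bK (base_point x0).
exists (M%:R + 1); first by have := ler0n R M; lra.
move=> x; rewrite (bp x x0) => Mx.
apply: (@le_lt_trans _ _ (e / 2)%:E); last by rewrite lte_fin; lra.
apply/ereal_supP => _ [_ [a xa <-] [_ [b xb <-] <-]]; rewrite lee_fin.
have nK : ~ K x by move=> /HM; lra.
have near y : ball x r y -> `|f x - f y| <= e / 4.
  by rewrite ballEmdist/= => xy; apply: HK => //; lra.
have := near a xa; have := near b xb; rewrite !ler_norml /=.
change (set_val (phi a)) with (f a); change (set_val (phi b)) with (f b).
by move=> /andP[? ?] /andP[? ?]; apply/andP; split; lra.
Qed.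

(** Zero at x and constantly 1 off the unit ball, it tells x from every point at infinity. *)
Lemma bump_function (x : X) : exists phi : set_type (higson_functions X),
  forall y, set_val (set_val phi y) = Num.min 1 (mdist x y).
Proof.
have tri y z : mdist x y <= mdist x z + mdist y z.
  by rewrite (metric_sym y z); exact: metric_triangle.
apply: (@higson_function _ 1).
- move=> y; rewrite ge_min lexx le_min ler01 mdist_ge0//.
- move=> y z; have := tri y z; have := tri z y; rewrite (metric_sym z y) ler_norml.
  have := mdist_ge0 y z.
  case: (leP 1 (mdist x y)); case: (leP 1 (mdist x z)) => ? ? ? ? ?;
    apply/andP; split; lra.
- move=> r e e0; exists [set y | mdist x y <= r%:R + 1].
    by apply: (@bnd_le _ _ _ x (r%:R + 1)).
  move=> y z /negP; rewrite /= -ltNge => ry yz; have := tri y z => yx.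
  rewrite !min_l ?subrr ?normr0 ?ltW//.
    by rewrite -(ltrD2r (mdist y z)); lra.
  by have := ler0n R r; lra.
Qed.

Definition dist_to (S : set X) (x : X) : R := inf [set mdist x s | s in S].

Lemma dist_to_has_lbound (S : set X) x : has_lbound [set mdist x s | s in S].
Proof. by exists 0 => _ [s _ <-]; exact: mdist_ge0. Qed.

Lemma dist_to_le (S : set X) x s : S s -> dist_to S x <= mdist x s.
Proof. by move=> Ss; apply: ge_inf; [exact: dist_to_has_lbound|exists s]. Qed.

Lemma le_dist_to (S : set X) x r : S !=set0 ->
  (forall s, S s -> r <= mdist x s) -> r <= dist_to S x.
Proof.
move=> [s Ss] H; apply: lb_le_inf; first by exists (mdist x s), s.
by move=> _ [t St <-]; exact: H.
Qed.

Lemma dist_to_lipschitz (S : set X) x y : S !=set0 ->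
  dist_to S x <= dist_to S y + mdist x y.
Proof.
move=> S0; rewrite -lerBlDr; apply: le_dist_to => // s Ss.
have := dist_to_le x Ss; have := metric_triangle x y s; lra.
Qed.

(** This is Urysohn's quotient a/(a+b) of distances to [S] and [T]. It oscillates slowly because
    asymptotic disjointness sends the denominator to infinity; the maximum with 1 keeps the
    denominator positive, and [K] contains the points where it matters. *)
Lemma separating_function (S T : set X) : S !=set0 -> T !=set0 -> asym_disj S T ->
  exists2 phi : set_type (higson_functions X),
    forall x, S x -> set_val (set_val phi x) = 0 &
    exists2 K, bnd K & forall x, T x -> ~ K x -> set_val (set_val phi x) = 1.
Proof.
move=> S0 T0 ST; pose a := dist_to S; pose b := dist_to T.
have a0 x : 0 <= a x by apply: le_dist_to => // s _; exact: mdist_ge0.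
have b0 x : 0 <= b x by apply: le_dist_to => // s _; exact: mdist_ge0.
have large (n : nat) : exists2 K, bnd K & forall x, ~ K x -> n%:R <= a x + b x.
  exists [set x | exists2 s, near_part (2 * n) S T s & mdist x s <= n%:R].
    exact/bnd_nbhd/ST.
  move=> x nK; rewrite leNgt; apply/negP => abn; apply: nK.
  have [s Ss xs] : exists2 s, S s & mdist x s <= n%:R.
    apply: contrapT => ns; suff : n%:R <= a x by have := b0 x; lra.
    apply: le_dist_to => // s Ss; rewrite leNgt; apply/negP => xs.
    by apply: ns; exists s => //; exact: ltW.
  have [t Tt xt] : exists2 t, T t & mdist x t <= n%:R.
    apply: contrapT => nt; suff : n%:R <= b x by have := a0 x; lra.
    apply: le_dist_to => // t Tt; rewrite leNgt; apply/negP => xt.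
    by apply: nt; exists t => //; exact: ltW.
  exists s => //; split=> //; exists t => //.
  have := metric_triangle s x t; rewrite (metric_sym s x) natrM; lra.
pose p x := Num.max 1 (a x + b x).
have p1 x : 1 <= p x by rewrite le_max lexx.
have ap x : a x <= p x.
  by rewrite le_max; apply/orP; right; have := b0 x; lra.
have aL x y : a x <= a y + mdist x y by exact: dist_to_lipschitz.
have bL x y : b x <= b y + mdist x y by exact: dist_to_lipschitz.
have pL x y : p x <= p y + 2 * mdist x y.
  have := aL x y; have := bL x y; have := mdist_ge0 x y; rewrite /p.
  case: (leP 1 (a x + b x)); case: (leP 1 (a y + b y)); lra.
have fL x y : `|a x / p x - a y / p y| <= 3 * mdist x y / p x.
  have px : 0 < p x by apply: lt_le_trans (p1 x).
  have py : 0 < p y by apply: lt_le_trans (p1 y).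
  have -> : a x / p x - a y / p y = (a x - a y + a y / p y * (p y - p x)) / p x.
    by field; rewrite !gt_eqF.
  rewrite normrM (ger0_norm (_ : 0 <= (p x)^-1)); last by rewrite invr_ge0 ltW.
  rewrite ler_wpM2r ?invr_ge0 ?(ltW px)//.
  have q0 : 0 <= a y / p y by rewrite divr_ge0// ltW.
  have q1 : a y / p y <= 1 by rewrite ler_pdivrMr// mul1r.
  rewrite (le_trans (ler_normD _ _))// normrM (ger0_norm q0).
  have h1 : `|a x - a y| <= mdist x y.
    have := aL x y; have := aL y x; rewrite (metric_sym y x) ler_norml => ? ?.
    by apply/andP; split; lra.
  have h2 : `|p y - p x| <= 2 * mdist x y.
    have := pL x y; have := pL y x; rewrite (metric_sym y x) ler_norml => ? ?.
    by apply/andP; split; lra.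
  have := ler_pM q0 (normr_ge0 _) q1 h2; rewrite mul1r; lra.
have [phi Hphi] : exists phi : set_type (higson_functions X),
    forall x, set_val (set_val phi x) = a x / p x.
  apply: (@higson_function _ 3).
  - move=> x; have px : 0 < p x by apply: lt_le_trans (p1 x).
    by rewrite divr_ge0 ?(ltW px)//= ler_pdivrMr// mul1r.
  - move=> x y; apply: le_trans (fL x y) _.
    have px : 0 < p x by apply: lt_le_trans (p1 x).
    by rewrite ler_pdivrMr// ler_peMr// mulr_ge0// mdist_ge0.
  - move=> r e e0; have [n rn] := natr_ge (3 * r%:R / e).
    have [K bK HK] := large n; exists K => // x y /HK nx xy.
    apply: le_trans (fL x y) _.
    have px : 0 < p x by apply: lt_le_trans (p1 x).
    rewrite ler_pdivrMr//; rewrite ler_pdivrMr// in rn.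
    have pn : n%:R <= p x by rewrite le_max nx orbT.
    have : n%:R * e <= p x * e by rewrite ler_wpM2r// ltW.
    by rewrite (mulrC e); lra.
exists phi.
  move=> x Sx; rewrite Hphi (_ : a x = 0) ?mul0r//.
  by apply/eqP; rewrite eq_le a0 andbT -(mdistxx x) dist_to_le.
have [K bK HK] := large 1%N; exists K => // x Tx /HK ab1.
have bx : b x = 0.
  by apply/eqP; rewrite eq_le b0 andbT -(mdistxx x) dist_to_le.
rewrite Hphi /p; rewrite bx addr0 in ab1 *.
by rewrite max_r// divff// gt_eqF// (lt_le_trans ltr01).
Qed.

End higson_functions.

Section corona.
Context {R : realType} (X : metricType R).
Local Notation cX := (higson_compactification X).
Local Notation emb := (@higson_embedding R X).
Local Notation value phi x := (set_val (set_val phi x)).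

Definition at_infinity (F : set_system X) := forall S, bnd S -> F (~` S).

Lemma closure_emb_ultra (S : set X) (z : cX) : closure (emb @` S) z ->
  exists F : set_system X, [/\ UltraFilter F, F S & emb @ F --> z].
Proof.
move=> Sz; pose G := filter_from (nbhs z) (fun U => S `&` emb @^-1` U).
have GF : ProperFilter G.
  apply: filter_from_proper; first apply: filter_from_filter.
  - by exists setT; exact: filterT.
  - move=> U V Uz Vz; exists (U `&` V); first exact: filterI.
    by move=> x [Sx [Ux Vx]].
  - by move=> U /Sz[_ [[x Sx <-] Ux]]; exists x.
have [F [FU GsF]] := ultraFilterLemma GF; exists F; split=> //.
  by apply: GsF; exists setT; [exact: filterT|exact: subIsetl].
by move=> U Uz; apply: GsF; exists U => //; exact: subIsetr.
Qed.

Lemma ultra_closure (F : set_system X) (S : set X) (z : cX) : ProperFilter F ->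
  F S -> emb @ F --> z -> closure (emb @` S) z.
Proof.
move=> FF FS Fz U Uz; have FU : F (emb @^-1` U) := Fz _ Uz.
by have [x [Sx Ux]] := filter_ex (filterI FS FU); exists (emb x); split=> //; exists x.
Qed.

Lemma ultra_limit (F : set_system X) : UltraFilter F -> exists z : cX, emb @ F --> z.
Proof.
move=> FU; have FT : (emb @ F) setT by exact: filterT.
have [z [_ clz]] := @compact_higson _ X (emb @ F) (fmap_proper_filter _ _) FT.
exists z => U Uz; have [//|FnU] := in_ultra_setVsetC (emb @^-1` U) FU.
have FnU' : (emb @ F) (~` U) by [].
by have [y []] := clz _ _ FnU' Uz.
Qed.

Lemma unbounded_ultra (S : set X) : ~ bnd S ->
  exists F : set_system X, [/\ UltraFilter F, F S & at_infinity F].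
Proof.
move=> nS; pose G := filter_from bnd (fun K => S `\` K).
have GF : ProperFilter G.
  apply: filter_from_proper; first apply: filter_from_filter.
  - by exists set0; exact: bnd0.
  - move=> K L bK bL; exists (K `|` L); first exact: bndU.
    by move=> x [Sx nKL]; split; split=> // h; apply: nKL; [left|right].
  - move=> K bK; apply: contrapT => nx; apply: nS; apply: sub_bnd bK => x Sx.
    by apply: contrapT => nKx; apply: nx; exists x.
have [F [FU GsF]] := ultraFilterLemma GF; exists F; split=> //.
  by apply: GsF; exists set0; [exact: bnd0|exact: subDsetl].
by move=> K bK; apply: GsF; exists K => // x [].
Qed.

Lemma higson_coord_near (F : set_system X) (z : cX)
    (phi : set_type (higson_functions X)) (e : R) : Filter F ->
  emb @ F --> z -> 0 < e -> F [set x | `|higson_coord phi z - value phi x| < e].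
Proof.
move=> FF Fz e0.
have Fphi : (higson_coord phi \o emb) @ F --> higson_coord phi z.
  by apply: cvg_comp Fz _; exact: higson_coord_continuous.
exact: (@cvgr_dist_lt _ _ _ _ _ _ _ Fphi _ e0).
Qed.

Lemma higson_coord_eq (F F' : set_system X) (z z' : cX) : ProperFilter F ->
  ProperFilter F' -> emb @ F --> z -> emb @ F' --> z' ->
  (forall (phi : set_type (higson_functions X)) (e : R), 0 < e ->
    forall S, F S -> forall S', F' S' ->
    exists x x', [/\ S x, S' x' & `|value phi x - value phi x'| <= e]) -> z = z'.
Proof.
move=> FF FF' Fz Fz' H; apply: higson_coord_inj => phi.
apply/eqP; rewrite -subr_eq0 -normr_eq0 eq_le normr_ge0 andbT.
apply/ler_addgt0Pl => e e0; rewrite addr0.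
have e3 : 0 < e / 3 by lra.
have [x [x' [xz xz' xx]]] :=
  H phi _ e3 _ (higson_coord_near phi FF Fz e3) _ (higson_coord_near phi FF' Fz' e3).
rewrite /= in xz xz'; have := ler_normD (higson_coord phi z - value phi x +
  (value phi x - value phi x')) (value phi x' - higson_coord phi z').
have := ler_normD (higson_coord phi z - value phi x) (value phi x - value phi x').
rewrite (distrC (value phi x') (higson_coord phi z')).
have -> : higson_coord phi z - value phi x + (value phi x - value phi x') +
  (value phi x' - higson_coord phi z') = higson_coord phi z - higson_coord phi z' by ring.
lra.
Qed.

Lemma infinity_corona (F : set_system X) (z : cX) : ProperFilter F ->
  at_infinity F -> emb @ F --> z -> ~ range emb z.
Proof.
move=> FF Finf Fz [x _ xz]; have [phi Hphi] := bump_function x.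
have zx : higson_coord phi z = 0.
  rewrite -xz; transitivity (value phi x) => //.
  by rewrite Hphi mdistxx min_r.
have bx : bnd [set y | mdist x y <= 1] by apply: (@bnd_le _ _ _ x 1).
have [y [/= xy]] := filter_ex (filterI (Finf _ bx) (higson_coord_near phi FF Fz ltr01)).
rewrite Hphi zx sub0r normrN min_l ?normr1 ?ltxx//.
by rewrite leNgt; apply/negP => /ltW.
Qed.

Context (hX : proper_metric X).

(** Properness enters here: the ultrafilter contains a compact ball, so it converges in [X], and
    continuous functions identify its limit with z. *)
Lemma bounded_ultra (F : set_system X) (z : cX) (S : set X) : UltraFilter F ->
  bnd S -> F S -> emb @ F --> z -> range emb z.
Proof.
move=> FU bS FS Fz; have [x0 _] := filter_ex FS.
have [M HM] := bS x0; have := @hX x0 M%:R; rewrite compact_ultra => cM.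
have [|x [_ Fx]] := cM F FU; first by apply: filterS FS => y /HM.
exists x => //; apply: (@higson_coord_eq (principal_filter x) F) => //.
- exact: principal_filter_proper.
- by move=> U Ux y ->; exact: (nbhs_singleton Ux).
- move=> phi e e0 S' S'x T FT; have [phic _] := set_valP phi.
  have c3 : continuous (set_val : unit_interval R -> R).
    exact: (@set_val_continuous R).
  have cphi : {for x, continuous (fun y => value phi y : R)}.
    exact: (continuous_comp (phic x) (c3 _)).
  have nx : nbhs x [set y | `|value phi x - value phi y| < e].
    exact: (@cvgr_dist_lt _ _ _ _ _ _ _ cphi _ e0).
  have Fe : F [set y | `|value phi x - value phi y| < e] := Fx _ nx.
  have [y [Ty xy]] := filter_ex (filterI FT Fe).
  exists x, y; split=> //; [exact: S'x|exact: ltW].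
Qed.

Lemma corona_infinity (F : set_system X) (z : cX) : UltraFilter F ->
  emb @ F --> z -> ~ range emb z -> at_infinity F.
Proof.
move=> FU Fz nz S bS; have [FS|//] := in_ultra_setVsetC S FU.
by exfalso; apply: nz; exact: bounded_ultra FS Fz.
Qed.

Lemma asym_disj_closure (S T : set X) (z : cX) : asym_disj S T ->
  ~ range emb z -> closure (emb @` S) z -> closure (emb @` T) z -> False.
Proof.
move=> ST nz /closure_emb_ultra[F [FU FS Fz]] /closure_emb_ultra[G [GU GT Gz]].
have [phi phiS [K bK phiT]] :=
  separating_function (filter_ex FS) (filter_ex GT) ST.
have h2 : (0 : R) < 1 / 2 by lra.
have [x [Sx /= ]] := filter_ex (filterI FS (higson_coord_near phi _ Fz h2)).
have GK := corona_infinity GU Gz nz bK.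
have [y [[Ty nKy] /=]] :=
  filter_ex (filterI (filterI GT GK) (higson_coord_near phi _ Gz h2)).
rewrite phiT// phiS// !ltr_norml => /andP[? ?] /andP[? ?]; lra.
Qed.

(** If the points of [S] within r of [T] are unbounded, move an ultrafilter at infinity on them to
    nearby points of [T]. Slowly oscillating functions do not notice the move, so both limits are
    one corona point. *)
Lemma closure_asym_disj (S T : set X) : (forall z : cX, ~ range emb z ->
  closure (emb @` S) z -> closure (emb @` T) z -> False) -> asym_disj S T.
Proof.
move=> H r; apply: contrapT => nb.
have [F [FU FG Finf]] := unbounded_ultra nb.
have /choice[y Hy] x : exists y, near_part r S T x -> T y /\ mdist x y <= r%:R.
  have [[Sx [y Ty xy]]|nx] := pselect (near_part r S T x); last by exists x.
  by exists y.
have [z Fz] := ultra_limit FU.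
have Fy : ProperFilter (y @ F) by exact: fmap_proper_filter.
have [G [GU FsG]] := ultraFilterLemma Fy.
have [z' Gz] := ultra_limit GU.
have GT : G T.
  apply: FsG; suff : F (y @^-1` T) by [].
  by apply: filterS FG => x /Hy[].
suff zz : z = z'.
  apply: (H z); first exact: infinity_corona Finf Fz.
    by apply: ultra_closure Fz; apply: filterS FG => x [].
  by rewrite zz; exact: ultra_closure Gz.
apply: (@higson_coord_eq F G) => // phi e e0 A FA B GB.
have [_ so] := set_valP phi.
have r0 : (0 : R) < r%:R + 1 by have := ler0n R r; lra.
have [D _ HD] := so _ _ r0 e0.
have [x0 _] := filter_ex FA.
have bp x := base_point_cst x x0.
have bD : bnd [set x | mdist (base_point x0) x <= D].
  by apply: (@bnd_le _ _ _ (base_point x0) D).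
have FyB : F (y @^-1` B).
  have [GyB|] := in_ultra_setVsetC (y @^-1` B) FU; first by [].
  move=> FnB; have : (y @ F) (~` B) by [].
  by move=> /FsG GnB; have [w []] := filter_ex (filterI GB GnB).
have [x [[[Ax Bx] Gx] /= /negP]] :=
  filter_ex (filterI (filterI (filterI FA FyB) FG) (Finf _ bD)).
rewrite -ltNge => /ltW Dx; exists x, (y x); split=> //.
have [_ xy] := Hy x Gx.
have := HD x; rewrite bp => /(_ Dx) /ltW /ereal_supP H'.
rewrite -lee_fin; apply: H'; exists (set_val phi x).
  by exists x => //; exact: ballxx.
exists (set_val phi (y x)) => //; exists (y x) => //.
by rewrite ballEmdist/=; lra.
Qed.

Lemma dense_emb (z : cX) : closure (range emb) z.
Proof.
move=> U [W [[G oG GW] Wz WU]]; rewrite -GW in Wz WU.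
have zc : closure (range (@higson_eval R X)) (set_val z) by exact: set_valP.
have [_ [[x _ <-] Gx]] := zc G (open_nbhs_nbhs (conj oG Wz)).
by exists (emb x); split; [exists x|exact: WU].
Qed.

(** It makes the corona closed in the compactification. Where the bump coordinate at x stays below
    1, limits come from ultrafilters containing the unit ball, so [bounded_ultra] applies. *)
Lemma open_range_emb : open (range emb).
Proof.
rewrite openE => z [x _ <-]; have [phi Hphi] := bump_function x.
have cx : higson_coord phi (emb x) = 0.
  by transitivity (value phi x) => //; rewrite Hphi mdistxx min_r.
have near1 : nbhs (emb x)
    [set w | `|higson_coord phi (emb x) - higson_coord phi w| < 1].
  have nF : Filter (nbhs (emb x)) := nbhs_filter _.
  exact: (@cvgr_dist_lt _ _ _ _ nF _ _ (@higson_coord_continuous _ X phi _) _ ltr01).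
apply: filterS near1 => w; rewrite /= cx sub0r normrN => w1.
have [F [FU _ Fw]] := closure_emb_ultra (@dense_emb w).
have e0 : 0 < 1 - `|higson_coord phi w| by lra.
apply: (bounded_ultra (S := [set y | mdist x y <= 1]) FU _ _ Fw).
  exact: (@bnd_le _ _ _ x 1).
apply: filterS (higson_coord_near phi _ Fw e0) => y; rewrite /= Hphi => wy.
rewrite leNgt; apply/negP => xy; move: wy; rewrite min_l ?(ltW xy)//.
have := ler_norm (higson_coord phi w); rewrite ltr_norml => ? /andP[? ?]; lra.
Qed.

End corona.

Lemma compact_normal_nbhs (T : topologicalType) (F G : set T) :
  hausdorff_space T -> compact [set: T] -> closed F -> open G -> F `<=` G ->
  exists W, [/\ open W, F `<=` W & closure W `<=` G].
Proof.
move=> hT cT cF oG FG.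
have [|W] := compact_normal hT cT cF (_ : set_nbhs F G).
  by apply/set_nbhsP; exists G; split.
move=> /set_nbhsP[V [oV FV VW]] WG; exists V; split=> //.
exact: subset_trans (closure_subset VW) WG.
Qed.

Lemma proper_set_type (R : realType) (X : metricType R) (C : set X) :
  proper_metric X -> closed C -> proper_metric (set_type C).
Proof.
move=> pX cC x r; pose K := [set y | mdist (set_val x) y <= r].
have cK : compact (C `&` K) by rewrite setIC; apply: compact_closedI => //; exact: pX.
exact: compact_set_type cK.
Qed.

(** * Asymptotic separators in metric terms *)

Section separators.
Context {R : realType} (X : metricType R).
Local Notation cX := (higson_compactification X).
Local Notation nX := (higson_corona X).
Local Notation emb := (@higson_embedding R X).
Context (hX : proper_metric X).

Let val_corona_continuous : continuous (set_val : nX -> cX).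
Proof. exact: (@set_val_continuous cX). Qed.

Let corona_notin (z : nX) : ~ range emb (set_val z).
Proof. exact: (@set_valP _ (~` range emb) z). Qed.

Lemma corona_traceU (S T : set X) :
  corona_trace (S `|` T) = corona_trace S `|` corona_trace T.
Proof. by rewrite /corona_trace image_setU closureU. Qed.

Lemma closed_corona_trace (S : set X) : closed (corona_trace S).
Proof.
have /continuous_closedP h := val_corona_continuous.
by apply: h; exact: closed_closure.
Qed.

Lemma corona_trace_disj (S T : set X) :
  asym_disj S T <-> corona_trace S `&` corona_trace T = set0.
Proof.
split=> [ST|ST].
  apply/seteqP; split=> // z [Sz Tz].
  exact: (asym_disj_closure hX ST (@corona_notin z) Sz Tz).
apply: closure_asym_disj => // z nz Sz Tz.
pose z' : nX := exist _ z (mem_set (nz : (~` range emb) z)).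
by have : (corona_trace S `&` corona_trace T) z' by []; rewrite ST.
Qed.

Lemma asymptotic_separator_metric (A B C : set X) :
  asymptotic_separator A B C -> metric_separator A B C.
Proof.
move=> [_ [U1 [U2 [oU1 oU2 U12 UC [AU BU]]]]].
pose side b S := corona_trace S `<=` if b then U1 else U2.
have sideU b S T : side b S -> side b T -> side b (S `|` T).
  by rewrite /side corona_traceU => SU TU z [/SU|/TU].
have UnC b : (if b then U1 else U2) `<=` ~` corona_trace C.
  by rewrite UC; case: b => z Uz; [left|right].
have side_asym b S : side b S -> asym_disj S C.
  move=> sS; apply/corona_trace_disj/seteqP; split=> // z [/sS Uz Cz].
  exact: UnC Uz Cz.
have side_disj S T : side true S -> side false T -> asym_disj S T.
  move=> sS sT; apply/corona_trace_disj/seteqP; split=> // z [/sS U1z /sT U2z].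
  by rewrite -U12.
suff side_cover E : asym_disj E C ->
    exists S T, [/\ E = S `|` T, side true S & side false T].
  have [g Hg] := all_separated_exists sideU side_cover side_disj side_asym.
  split; [exact: side_asym true _ AU|exact: side_asym false _ BU|exists g => i].
  exact: Hg.
move=> /corona_trace_disj EC.
have EU z : corona_trace E z -> (U1 `|` U2) z.
  by move=> Ez; rewrite -UC => Cz; have : set0 z by rewrite -EC.
have [V1 oV1 VU1] := oU1; have [V2 oV2 VU2] := oU2.
(* The trace of [E] is parted inside the normal space [cX]: an open [W] contains its part outside
   [V2], and the closure of [W] misses its part outside [V1]. *)
pose F1 := closure (emb @` E) `&` ~` range emb `&` ~` V2.
pose G1 := ~` (closure (emb @` E) `&` ~` range emb `&` ~` V1).
have cR : closed (~` range emb) by exact/open_closedC/open_range_emb.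
have cF1 : closed F1.
  by apply: closedI; [apply: closedI => //; exact: closed_closure|exact: open_closedC].
have oG1 : open G1.
  apply: closed_openC; apply: closedI; last exact: open_closedC.
  by apply: closedI => //; exact: closed_closure.
have FG1 : F1 `<=` G1.
  move=> z [[Ez nz] nV2] [_ nV1].
  pose z' : nX := exist _ z (mem_set (nz : (~` range emb) z)).
  have [U1z|U2z] := @EU z' Ez.
    by apply: nV1; move: U1z; rewrite -VU1.
  by apply: nV2; move: U2z; rewrite -VU2.
have [W [oW FW WG]] := compact_normal_nbhs (@hausdorff_higson R X)
  (@compact_higson R X) cF1 oG1 FG1.
exists (E `&` emb @^-1` W), (E `\` emb @^-1` W); split.
- by rewrite setDE -setIUr setUv setIT.
- move=> z Sz; have Ez : corona_trace E z.
    by move: Sz; apply/closure_subset/image_subset; exact: subIsetl.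
  have Wz : closure W (set_val z).
    by move: Sz; apply: closure_subset => _ [x [_ Wx] <-].
  have [//|U2z] := EU z Ez; exfalso; apply: (WG _ Wz); split.
    by split=> //; exact: corona_notin.
  move=> V1z; have : (U1 `&` U2) z by split=> //; rewrite -VU1.
  by rewrite U12.
- move=> z Tz; have Ez : corona_trace E z.
    by move: Tz; apply/closure_subset/image_subset; exact: subDsetl.
  have [U1z|//] := EU z Ez; exfalso.
  have Wz : W (set_val z).
    apply: FW; split; first by split=> //; exact: corona_notin.
    move=> V2z; have : (U1 `&` U2) z by split=> //; rewrite -VU2.
    by rewrite U12.
  by have [_ [[x [_ nWx] <-] Wx]] := Tz W (open_nbhs_nbhs (conj oW Wz)).
Qed.

(** The open pieces are the complements of the traces of [C] with [U2] and of [C] with [U1]. A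
    corona point off the trace of [C] has a neighbourhood whose points of [X] form a set E
    asymptotically disjoint from [C]; the hypothesis on E forbids it to adhere to both [U1] and
    [U2]. *)
Lemma asymptotic_separator_criterion (A B C U1 U2 : set X) : closed C ->
  (forall x, [\/ C x, U1 x | U2 x]) ->
  (forall E, asym_disj E C -> asym_disj (E `&` U1) (E `&` U2)) ->
  asym_disj A (C `|` U2) -> asym_disj B (C `|` U1) -> asymptotic_separator A B C.
Proof.
move=> cC CU EU /corona_trace_disj AC /corona_trace_disj BC; split=> //.
exists (~` corona_trace (C `|` U2)), (~` corona_trace (C `|` U1)); split.
- exact/closed_openC/closed_corona_trace.
- exact/closed_openC/closed_corona_trace.
- apply/seteqP; split=> // z [nz1 nz2].
  have : corona_trace ((C `|` U2) `|` (C `|` U1)) z.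
    rewrite /corona_trace (_ : _ `|` _ = setT); first exact: dense_emb.
    by apply/seteqP; split=> // x _; have [] := CU x; [left; left|right; right|left; right].
  by rewrite corona_traceU => -[].
- apply/seteqP; split=> z.
    move=> nCz; apply: contrapT => /not_orP[/contrapT + /contrapT].
    rewrite !corona_traceU => -[//|U2z] [//|U1z].
    have c1 : closed [set set_val z : cX].
      exact/accessible_closed_set1/hausdorff_accessible/hausdorff_higson.
    have oC : open (~` closure (emb @` C)) by exact/closed_openC/closed_closure.
    have [_ ->|W [oW zW WC]] := compact_normal_nbhs (@hausdorff_higson R X)
      (@compact_higson R X) c1 oC; first exact: nCz.
    have Wz : nbhs (set_val z) W by apply: open_nbhs_nbhs; split=> //; exact: zW.
    pose E := emb @^-1` W.
    have EC : asym_disj E C.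
      apply/corona_trace_disj/seteqP; split=> // y [Ey Cy].
      apply: (WC (set_val y)) => //; move: Ey; apply: closure_subset.
      by move=> _ [x Wx <-].
    have cut (S : set X) : corona_trace S z -> corona_trace (E `&` S) z.
      move=> Sz U Uz; have [_ [[x Sx <-] [Ux Wx]]] := Sz _ (filterI Uz Wz).
      by exists (emb x); split=> //; exists x.
    have /corona_trace_disj H := EU _ EC.
    have : (corona_trace (E `&` U1) `&` corona_trace (E `&` U2)) z.
      by split; exact: cut.
    by rewrite H.
  by rewrite !corona_traceU => -[nz Cz|nz Cz]; apply: nz; left.
- by split=> z Sz Cz; [have : set0 z by rewrite -AC|have : set0 z by rewrite -BC].
Qed.

End separators.

(** * Sum theorem *)

(** For each k take a witness for the largest solvable i up to k; by monotonicity it serves all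
    smaller i. *)
Lemma diagonal_choice (T : Type) (t0 : T) (P : nat -> nat -> T -> Prop) :
  (forall k i j t, (i <= j)%N -> P k j t -> P k i t) ->
  (forall i, exists K, forall k, (K <= k)%N -> exists t, P k i t) ->
  exists c : nat -> T, forall i, exists K, forall k, (K <= k)%N -> P k i (c k).
Proof.
move=> Pmono PK.
have best k m : exists c, forall i, (i <= m)%N -> (exists t, P k i t) -> P k i c.
  elim: m => [|m [c Hc]].
    have [[t Pt]|nt] := pselect (exists t, P k 0%N t); last first.
      by exists t0 => i; rewrite leqn0 => /eqP ->.
    by exists t => i; rewrite leqn0 => /eqP ->.
  have [[t Pt]|nt] := pselect (exists t, P k m.+1 t).
    by exists t => i im _; exact: Pmono Pt.
  by exists c => i; rewrite leq_eqVlt => /predU1P[->//|]; rewrite ltnS; exact: Hc.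
have [c Hc] := choice (fun k => best k k).
exists c => i; have [K HK] := PK i; exists (maxn K i) => k.
by rewrite geq_max => /andP[Kk ik]; apply: Hc => //; exact: HK.
Qed.

Section separator_in_union.
Context {R : realType} (X : metricType R).

Lemma spread_closed (C : set X) :
  (forall x y, C x -> C y -> x <> y -> 8 <= mdist x y) -> closed C.
Proof.
move=> sC z Cz; have [|y [Cy]] := Cz (ball z 1); first exact: nbhsx_ballx.
rewrite ballEmdist/= => zy; have [->//|yz] := eqVneq z y.
have zy0 : 0 < mdist z y by rewrite mdist_gt0.
have [|w [Cw]] := Cz (ball z (mdist z y)); first exact: nbhsx_ballx.
rewrite ballEmdist/= => zw; exfalso.
have wy : w <> y by move=> e; rewrite e ltxx in zw.
have := sC _ _ Cw Cy wy; have := metric_triangle w z y.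
rewrite (metric_sym w z); lra.
Qed.

Lemma asym_disj_outside (A O : set X) : asym_disj A (~` O) -> bnd (A `\` O).
Proof. exact: asym_disjI. Qed.

(* Only the part of X covered by S2 is cut by a set of smaller dimension; the
   points of S1 away from A and B are all put in the separator. *)
Lemma separator_in_union (S1 S2 : nat -> set X) n g (A B : set X) :
  proper_metric X -> blocks S2 ->
  (forall x, (\bigcup_k S1 k) x \/ (\bigcup_k S2 k) x) ->
  (forall i, exists K, forall k, (K <= k)%N -> dim_approx n.+1 i g (S2 k)) ->
  asym_disj A B -> exists C (C2 : nat -> set X), [/\ asymptotic_separator A B C,
    C `<=` (\bigcup_k S1 k) `|` (\bigcup_k C2 k), forall k, C2 k `<=` S2 k &
    forall i, exists K, forall k, (K <= k)%N -> dim_approx n i g (C2 k)].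
Proof.
move=> hX bS2 cover QS2 AB.
(* Nested neighbourhoods: [A] deep in [OA], [OA] deep in [Ap], likewise for [B], with [Ap] and [Bp]
   asymptotically disjoint. The collars absorb steps of bounded length. *)
have [Ap [AAp ApB]] := asym_disj_interp AB.
have [Bp [BBp BpAp]] := asym_disj_interp (asym_disjC ApB).
have [OA [AOA OAp]] := asym_disj_interp AAp.
have [OB [BOB OBp]] := asym_disj_interp BBp.
pose P k i (CV : set X * set X) := let: (C, V) := CV in
  [/\ C `<=` S2 k, C `&` Ap = set0 /\ C `&` Bp = set0,
    S2 k `&` Ap `<=` V /\ S2 k `&` Bp `<=` ~` V,
    step_closed i g (S2 k) C V & dim_approx n i g C].
have [||CV HCV] := @diagonal_choice _ (set0, set0) P.
- move=> k i j [C V] ij [H1 H2 H3 H4 H5]; split=> //; last exact: dim_approx_mono H5.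
  by move=> s x y si; apply: H4; exact: leq_trans ij.
- move=> i; have [K1 HK1] := QS2 i.
  have [K2 HK2] := blocks_far bS2 (asym_disjC BpAp (g i)).
  exists (maxn K1 K2) => k; rewrite geq_max => /andP[/HK1 Qk /HK2 farK].
  have [||||a b [Aa Sa] [Bb Sb]|C [CS CA CB [V [V1 V2 V3]] QC]] :=
    Qk i (S2 k) (Ap `&` S2 k) (Bp `&` S2 k) => //.
  + rewrite leNgt; apply/negP => ab; apply: (farK a) => //; split=> //.
    by exists b => //; exact: ltW.
  exists (C, V); split=> //; split.
  + apply/seteqP; split=> // x [Cx Ax].
    have : (C `&` (Ap `&` S2 k)) x by split=> //; split=> //; exact: CS.
    by rewrite CA.
  + apply/seteqP; split=> // x [Cx Bx].
    have : (C `&` (Bp `&` S2 k)) x by split=> //; split=> //; exact: CS.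
    by rewrite CB.
  + by move=> x [Sx Ax]; apply: V1.
  + by move=> x [Sx Bx]; apply: V2.
(* The diagonal choice promises nothing for small k, yet the inclusion in [S2 k] must hold for all
   k. *)
pose C2 k := if pselect ((CV k).1 `<=` S2 k) then (CV k).1 else set0.
pose V k := (CV k).2.
have {}HCV i : exists K, forall k, (K <= k)%N -> P k i (C2 k, V k).
  have [K HK] := HCV i; exists K => k /HK; rewrite /C2 /V.
  by case: (CV k) => C W /= [H1 H2 H3 H4 H5]; case: pselect.
have C2S k : C2 k `<=` S2 k by rewrite /C2; case: pselect => // _ x [].
pose S1u := \bigcup_k S1 k; pose C2u := \bigcup_k C2 k.
pose VV := [set x | exists2 k, S2 k x & V k x].
pose C0 := C2u `|` (S1u `\` (OA `|` OB)).
(* An 8-separated net of [C0] is closed, and [C0] lies within distance 8 of it. *)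
have [C [CC0 Csep Ccov]] := graded_net C0 (fun=> 1%N).
have cC : closed C by apply: spread_closed => x y Cx Cy xy; exact: Csep.
have EC0 E : asym_disj E C -> asym_disj E C0.
  move=> EC r; apply: sub_bnd (EC (r + 8)%N) => x [Ex [c C0c xc]]; split=> //.
  have [y [Cy _ cy]] := Ccov c C0c; exists y => //.
  have := metric_triangle x c y; rewrite natrD; move: cy; rewrite muln1; lra.
(* Off [C0] a point of [S1u] lies in [OA] or [OB], so [VV] has to decide only about points covered
   by [S2] alone. *)
pose U1 := OA `|` (~` OB `&` VV `&` ~` S1u).
have [K0 bK0 C2K0] : exists2 K, bnd K & C2u `<=` K `|` (~` Ap `&` ~` Bp).
  have [K HK] := HCV 0%N.
  exists [set x | exists2 k, (k < K)%N & S2 k x].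
    by apply: bnd_bigU => k _; exact: bS2.1.
  move=> x [k _ Cx]; have [kK|/HK[_ [CA CB] _ _ _]] := ltnP k K.
    by left; exists k => //; exact: C2S.
  right; split=> h; first by have : (C2 k `&` Ap) x by []; rewrite CA.
  by have : (C2 k `&` Bp) x by []; rewrite CB.
have AC0 : asym_disj A C0.
  apply: asym_disjUr; last first.
    by apply: asym_disj_sub AOA => // x [_ nO] Ox; apply: nO; left.
  apply: (@asym_disj_sub _ _ A (K0 `|` (~` Ap `&` ~` Bp))) => //.
  apply: asym_disjUr.
    exact/asym_disjC/asym_disj_bnd.
  by apply: asym_disj_sub AAp => // x [].
have BC0 : asym_disj B C0.
  apply: asym_disjUr; last first.
    by apply: asym_disj_sub BOB => // x [_ nO] Ox; apply: nO; right.
  apply: (@asym_disj_sub _ _ B (K0 `|` (~` Ap `&` ~` Bp))) => //.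
  apply: asym_disjUr.
    exact/asym_disjC/asym_disj_bnd.
  by apply: asym_disj_sub BBp => // x [].
exists C, C2; split=> //; first last.
- by move=> i; have [K HK] := HCV i; exists K => k /HK[].
- by move=> x /CC0[Cx|[Sx _]]; [right|left].
apply: (@asymptotic_separator_criterion _ _ hX _ _ _ U1 (~` U1)) => //.
- by move=> x; have [?|?] := pselect (U1 x); [constructor 2|constructor 3].
- move=> E /EC0 EC r.
  (* Precision [r.+1], since precision i controls steps of length less than i. *)
  have [K1 HK1] := HCV r.+1; have [K2 HK2] := bS2.2 r.
  pose W := near_part 0 E C0 `|` (near_part r OA (~` Ap) `|`
    (near_part r OB (~` Bp) `|` (near_part r Ap Bp `|`
    (near_part (g r) E C0 `|`
     [set x | exists2 k, (k < maxn K1 K2)%N & S2 k x])))).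
  have bW : bnd W.
    apply: bndU (EC 0%N) (bndU (OAp r) (bndU (OBp r) _)).
    apply: bndU (asym_disjC BpAp r) (bndU (EC (g r)) _).
    by apply: bnd_bigU => k _; exact: bS2.1.
  apply: sub_bnd (bndU bW (bnd_nbhd r bW)) => x [[Ex U1x] [y [Ey nU1y] xy]].
  apply: contrapT => /not_orP[nWx nWy'].
  have nWy : ~ W y by move=> Wy; apply: nWy'; exists y.
  have nC0 z : E z -> ~ W z -> ~ C0 z.
    by move=> Ez nW Cz; apply: nW; left; split=> //; exists z; rewrite ?mdistxx.
  have inS2 z : E z -> ~ W z -> ~ OA z -> ~ OB z -> ~ S1u z /\
      exists2 k, (maxn K1 K2 <= k)%N & S2 k z.
    move=> Ez nW nA nB; have nS1 : ~ S1u z.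
      by move=> Sz; apply: (nC0 z Ez nW); right; split=> // -[].
    split=> //; have [//|[k _ Sz]] := cover z; exists k => //.
    by rewrite leqNgt; apply/negP => kK; apply: nW; do 5 right; exists k.
  have [nAy nVy] : ~ OA y /\ ~ (~` OB `&` VV `&` ~` S1u) y.
    by split=> h; apply: nU1y; [left|right].
  have [OAx|nAx] := pselect (OA x).
    have Apy : Ap y.
      apply: contrapT => nA; apply: nWx; right; left; split=> //; by exists y.
    have [OBy|nBy] := pselect (OB y).
      have Apx : Ap x.
        apply: contrapT => nA; apply: nWx; right; left; split=> //.
        by exists x; rewrite ?mdistxx.
      have Bpy : Bp y.
        apply: contrapT => nB; apply: nWy; right; right; left; split=> //.
        by exists y; rewrite ?mdistxx.
      by apply: nWx; do 3 right; left; split=> //; exists y.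
    have [nS1 [k]] := inS2 y Ey nWy nAy nBy; rewrite geq_max => /andP[/HK1 Pk _] Sy.
    have [_ _ [VA _] _ _] := Pk.
    by apply: nVy; split=> //; split=> //; exists k => //; exact: VA.
  have [//|[[nBx [k Sx Vx]] nS1x]] := U1x.
  have kK : (maxn K1 K2 <= k)%N.
    by rewrite leqNgt; apply/negP => kK; apply: nWx; do 5 right; exists k.
  move: kK; rewrite geq_max => /andP[/HK1[_ _ [_ VB] Vstep _] kK2].
  have [OBy|nBy] := pselect (OB y).
    have Bpx : Bp x.
      apply: contrapT => nB; apply: nWy; right; right; left; split=> //.
      by exists x => //; rewrite metric_sym.
    exact: (VB x (conj Sx Bpx) Vx).
  have [nS1 [l _ Sy]] := inS2 y Ey nWy nAy nBy.
  have [kl|/eqP kl] := eqVneq k l; last first.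
    by have := HK2 k l kK2 kl x y Sx Sy; rewrite ltNge xy.
  rewrite -kl in Sy; apply: nVy; split=> //; split=> //; exists k => //.
  have farC z : E z -> ~ W z -> far (g r) (C2 k) z.
    move=> Ez nW c Cc; rewrite ltNge; apply/negP => zc; apply: nW.
    by do 4 right; left; split=> //; exists c => //; left; exists k.
  by apply: (Vstep r x y) Vx => //; exact: farC.
- apply: asym_disjUr; first exact: asym_disj_sub AC0.
  by apply: asym_disj_sub AOA => // x nU Ox; apply: nU; left.
- apply: asym_disjUr; first exact: asym_disj_sub BC0.
  apply: asym_disjUr; last by apply: asym_disj_sub BOB => // x [[]].
  apply: (@asym_disj_sub _ _ B (Ap `|` (OA `\` Ap))) => //.
    by move=> x Ox; have [?|?] := pselect (Ap x); [left|right].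
  apply: asym_disjUr; first exact: asym_disjC.
  exact/asym_disjC/asym_disj_bnd/asym_disj_outside.
Qed.

End separator_in_union.

(** * From transfinite to finite dimension *)

Section finiteness.
Context {R : realType}.

Lemma bounded_metricP (X : metricType R) : bounded_metric X <-> bnd [set: X].
Proof.
split=> [[M HM] x|bX]; first exact: (@bnd_le _ _ _ x M).
have [[x _]|nX] := pselect (exists x : X, True); last first.
  by exists 0 => x; exfalso; apply: nX; exists x.
have [M HM] := bX x; exists (M%:R + M%:R) => y z.
have := HM y I; have := HM z I; have := metric_triangle y x z.
rewrite (metric_sym y x); lra.
Qed.

Lemma bounded_uniformly_finite (X : metricType R) :
  bounded_metric X -> uniformly_finite X.
Proof.
move=> /bounded_metricP bX Z bZ; exists 0%N, (fun=> 0%N) => i.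
have [K HK] := blocks_far bZ bX; exists K => k Kk.
by apply/seteqP; split=> // x Zx; exact: (HK k Kk x Zx).
Qed.

Lemma uniformly_finite_step (X : metricType R) : proper_metric X ->
  (forall A B : set X, asymptotically_disjoint A B ->
    exists2 C : set X, asymptotic_separator A B C & uniformly_finite (set_type C)) ->
  uniformly_finite X.
Proof.
move=> hX sepX; apply: uniformly_finite_separators => A B /asym_disjP/sepX[C sC uC].
by exists C => //; exact: asymptotic_separator_metric.
Qed.

Lemma trasInd_uniformly_finite (a : ord) (X : metricType R) :
  trasInd_le a X -> proper_metric X -> uniformly_finite X.
Proof.
(* The recursion is on the derivation, whose smaller derivations sit under an existential and a
   disjunction; this is the induction on the ordinal. *)
revert a X; fix IH 3; intros a X H hX; destruct H as [H].
apply (uniformly_finite_step hX); intros A B AB.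
destruct (H A B AB) as [C sepC tC]; exists C; [exact sepC|].
destruct tC as [bC|[b _ tC]]; [exact (bounded_uniformly_finite bC)|].
exact (IH b _ tC (proper_set_type hX (proj1 sepC))).
Qed.

Lemma blocks_set_type (X : metricType R) (C : set X) (Z : nat -> set X) :
  blocks Z -> blocks (fun k => set_val @^-1` Z k : set (set_type C)).
Proof.
move=> [bZ HZ]; split=> [k x|M].
  by have [M HM] := bZ k (set_val x); exists M => y; exact: HM.
by have [K HK] := HZ M; exists K => k l Kk kl x y; exact: HK.
Qed.

Lemma dim_approx_set_type (X : metricType R) (C : set X) (Z : nat -> set X) n g :
  (forall i, exists K, forall k, (K <= k)%N -> dim_approx n i g (Z k)) ->
  forall i, exists K, forall k, (K <= k)%N ->
    dim_approx n i (fun s => 2 * g (2 * s))%N (set_val @^-1` Z k : set (set_type C)).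
Proof.
move=> QZ i; have [K HK] := QZ (2 * i)%N; exists K => k /HK.
have d (x y : set_type C) : mdist (set_val x) (set_val y) = mdist x y :> R by [].
apply: (@dim_approx_bilip _ _ _ (set_val : set_type C -> X)) => // x y _ _;
  by rewrite d; have := mdist_ge0 x y; lra.
Qed.

(** Counting dimension plus one turns the sum theorem into plain addition and makes -1 the base
    case. *)
Definition asInd_lt n (X : metricType R) : Prop :=
  if n is m.+1 then asInd_le m X else bounded_metric X.

(** The separator is covered by [S1] and by subsets of [S2] with bound one less, so the sum of the
    bounds drops by one. *)
Lemma asInd_lt_union n (X : metricType R) (S1 S2 : nat -> set X) n1 n2 g1 g2 :
  proper_metric X -> blocks S1 -> blocks S2 ->
  (forall x, (\bigcup_k S1 k) x \/ (\bigcup_k S2 k) x) ->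
  (forall i, exists K, forall k, (K <= k)%N -> dim_approx n1 i g1 (S1 k)) ->
  (forall i, exists K, forall k, (K <= k)%N -> dim_approx n2 i g2 (S2 k)) ->
  (n1 + n2 = n)%N -> asInd_lt n X.
Proof.
elim: n X S1 S2 n1 n2 g1 g2 => [|n IH] X S1 S2 n1 n2 g1 g2 hX b1 b2 cover Q1 Q2.
  move=> /eqP; rewrite addn_eq0 => /andP[/eqP n10 /eqP n20].
  rewrite n10 n20 /= in Q1 Q2.
  have [K1 HK1] := Q1 0%N; have [K2 HK2] := Q2 0%N.
  apply/bounded_metricP; apply: sub_bnd (bndU
    (@bnd_bigU _ _ S1 K1 (fun k _ => b1.1 k))
    (@bnd_bigU _ _ S2 K2 (fun k _ => b2.1 k))) => x _.
  by have [[k _ Sx]|[k _ Sx]] := cover x; [left|right]; exists k => //;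
    rewrite ltnNge; apply/negP; [move=> /HK1|move=> /HK2] => S0; rewrite S0 in Sx.
wlog : S1 S2 n1 n2 g1 g2 b1 b2 cover Q1 Q2 / (0 < n2)%N.
  move=> H n12; have [n20|] := ltnP 0 n2; first exact: (H S1 S2 n1 n2 g1 g2).
  rewrite leqn0 => /eqP n20; rewrite n20 addn0 in n12.
  apply: (H S2 S1 n2 n1 g2 g1) => //; last by rewrite n20.
    by move=> x; have [|] := cover x; [right|left].
  by rewrite n12.
case: n2 Q2 => [//|n2] Q2 _; rewrite addnS => -[nn].
have step A B : asymptotically_disjoint A B -> exists2 C : set X,
    asymptotic_separator A B C & asInd_lt n (set_type C).
  move=> /asym_disjP AB.
  have [C [C2 [sepC CC C2S QC]]] := separator_in_union hX b2 cover Q2 AB.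
  exists C => //.
  have QC1 := dim_approx_set_type C Q1; have QC2 := dim_approx_set_type C QC.
  apply: (IH _ _ _ _ _ _ _ _ _ _ _ QC1 QC2 nn).
  - by apply: proper_set_type => //; case: sepC.
  - exact: blocks_set_type.
  - exact/blocks_set_type/(sub_blocks C2S).
  - move=> x; have [[k _ Sx]|[k _ Cx]] := CC _ (set_valP x).
      by left; exists k.
    by right; exists k.
by case: n IH nn step.
Qed.

(** Quadratic radii make the widths of the shells, hence the gaps between shells of equal parity,
    tend to infinity. *)
Definition shell (X : metricType R) (x0 : X) (j : nat) : set X :=
  [set x | (j ^ 2)%:R <= mdist x0 x < (j.+1 ^ 2)%:R].

Lemma shell_cover (X : metricType R) (x0 x : X) : exists j, shell x0 j x.
Proof.
have ex : exists j, mdist x0 x < (j.+1 ^ 2)%:R.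
  have [n xn] := natr_ge (mdist x0 x); exists n.
  by rewrite (le_lt_trans xn)// ltr_nat; nia.
case: (ex_minnP ex) => j xj minj; exists j; rewrite /shell/= xj andbT.
case: j xj minj => [_ _|j xj minj]; first exact: mdist_ge0.
by rewrite leNgt; apply/negP => /minj; rewrite ltnn.
Qed.

Lemma shell_blocks (X : metricType R) (x0 : X) (b : bool) :
  blocks (fun k => shell x0 (b + k.*2)).
Proof.
split=> [k|M].
  apply: (@bnd_le _ _ _ x0 ((b + k.*2).+1 ^ 2)%:R) => y /andP[_ /ltW].
  exact.
have far (k l : nat) x y : (M <= k)%N -> (k < l)%N -> shell x0 (b + k.*2) x ->
    shell x0 (b + l.*2) y -> M%:R < mdist x y.
  move=> Mk kl /andP[_ xk] /andP[yl _].
  have := metric_triangle x0 x y.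
  have : (M + (b + k.*2).+1 ^ 2)%:R < ((b + l.*2) ^ 2)%:R :> R.
    rewrite ltr_nat -!addnn; nia.
  rewrite natrD; lra.
have near (k l : nat) x y : (M <= k)%N -> (l < k)%N -> shell x0 (b + k.*2) x ->
    shell x0 (b + l.*2) y -> M%:R < mdist x y.
  move=> Mk lk /andP[kx _] /andP[_ yl].
  have := metric_triangle x0 y x; rewrite (metric_sym y x).
  have : (M + (b + l.*2).+1 ^ 2)%:R < ((b + k.*2) ^ 2)%:R :> R.
    rewrite ltr_nat -!addnn; nia.
  rewrite natrD; lra.
exists M => k l Mk kl x y.
by have [lt|gt|//] := ltngtP k l; [exact: far|exact: near].
Qed.

Lemma uniformly_finite_asInd (X : metricType R) : proper_metric X ->
  uniformly_finite X -> exists n, asInd_lt n X.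
Proof.
move=> hX uX; have [[x0 _]|nX] := pselect (exists x : X, True); last first.
  by exists 0%N, 0 => x; exfalso; apply: nX; exists x.
have b0 := shell_blocks x0 false; have b1 := shell_blocks x0 true.
have [n0 [g0 Q0]] := uX _ b0; have [n1 [g1 Q1]] := uX _ b1.
exists (n0 + n1)%N; apply: (asInd_lt_union hX b0 b1 _ Q0 Q1) => // x.
have [j xj] := shell_cover x0 x; rewrite -(odd_double_half j) in xj.
by move: xj; case: (odd j) => xj; [right|left]; exists j./2.
Qed.

End finiteness.

Theorem theorem5 (R : realType) (X : metricType R) (hX : proper_metric X) :
  trasInd_lt_infinity X -> asInd_lt_infinity X.
Proof.
move=> [v Xv v_fin].
have [bX|nbX] := pselect (bounded_metric X); first by exists DimMinusOne.
have uX : uniformly_finite X.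
  case: v Xv v_fin => [//|a [_ ta _] _|//]; exact: trasInd_uniformly_finite ta hX.
have [[//|n] Xn] := uniformly_finite_asInd hX uX.
have ex : exists n, `[< asInd_le n X >] by exists n; exact/asboolP.
case: (ex_minnP ex) => m /asboolP Xm minm.
exists (DimValue m) => //; split=> // k km /asboolP /minm.
by rewrite leqNgt km.
Qed.
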